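(* Let $p\in R_{2d}$. For any integer $r\ge d$, we have $$p_{\min}-\mathrm{sp}_r(p)\le\gamma(Q(p))\cdot\frac{\sqrt{N_{n,d}}}{\alpha_d}\cdot\frac{4d(n-1)}{r+1},$$ where $\alpha_d=2^d/\binom{2d}{d}$, $N_{n,d}=\binom{n+d-1}{d}$, and $$\gamma(Q(p))=\max\{\lambda_{\max}(Q(p))-\mathrm{sp}_d(p),\;p_{\min}-\lambda_{\min}(Q(p))\}.$$
   Context: $R_{2d}$ is the space of real homogeneous polynomials of degree $2d$ in $x=(x_1,\dots,x_n)$, $d\ge1$; $s=x_1^2+\cdots+x_n^2$; $p_{\min}=\min\{p(x):x\in\mathbb R^n,\|x\|_2=1\}$. Let $[n]=\{1,\dots,n\}$. A matrix $A\in\mathbb R^{[n]^d\times[n]^d}$ is maximally symmetric if, viewed as a $2d$-tensor with entries $A_{\underline i,\underline j}$ at position $\underline i\,\underline j\in[n]^{2d}$, it is invariant under all permutations of the $2d$ indices. Every $f\in R_{2d}$ has a unique maximally symmetric matrix $\mathrm{MaxSym}(f)\in\mathbb R^{[n]^d\times[n]^d}$ with $f(x)=\langle\mathrm{MaxSym}(f),(xx^T)^{\otimes d}\rangle$ (trace inner product). Set $Q(p)=\mathrm{MaxSym}(p)$ and $M=\mathrm{MaxSym}(s^d)$. $\lambda_{\max}(\cdot)$ and $\lambda_{\min}(\cdot)$ denote the largest and smallest eigenvalues of a matrix (for $Q(p)$, as an $n^d\times n^d$ matrix). Let $\Pi_r$ be the orthogonal projection of $(\mathbb R^n)^{\otimes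 r}$ onto the subspace $S^r(\mathbb R^n)$ of symmetric $r$-tensors. For $r\ge d$ set $Q_r(p)=\Pi_r(Q(p)\otimes I_n^{\otimes(r-d)})\Pi_r$ and $M_r=\Pi_r(M\otimes I_n^{\otimes(r-d)})\Pi_r$. The spectral bound is $\mathrm{sp}_r(p)=\max\{\nu\in\mathbb R: Q_r(p)-\nu M_r\succeq0\}=\min\{v^TQ_r(p)v: v\in S^r(\mathbb R^n),\,v^TM_rv=1\}$. *)

(* Defs.v *)
From mathcomp Require Import all_boot all_order all_algebra all_fingroup.
From mathcomp Require Import boolp classical_sets reals.
From mathcomp Require Import mpoly.

Set Implicit Arguments.
Unset Strict Implicit.
Unset Printing Implicit Defensive.

Import Order.TTheory GRing.Theory Num.Theory.
Local Open Scope classical_set_scope.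
Local Open Scope ring_scope.

(* 0 is a default value, returned when the extremum is not attained. *)
Definition set_min (R : realType) (A : set R) : R :=
  xget 0 [set m | A m /\ lbound A m].

Definition set_max (R : realType) (A : set R) : R :=
  xget 0 [set m | A m /\ ubound A m].

Definition is_form (R : realType) (n k : nat) (p : {mpoly R[n]}) : Prop :=
  p \is k.-homog.

Definition cvmeval (R : realType) (n : nat) (p : {mpoly R[n]}) (x : 'cV[R]_n)
  : R := p.@[fun i => x i 0].

Definition norm2 (R : realType) (n : nat) (x : 'cV[R]_n) : R :=
  Num.sqrt (\sum_i x i 0 ^+ 2).

Definition pmin (R : realType) (n : nat) (p : {mpoly R[n]}) : R :=
  set_min [set cvmeval p x | x in [set x : 'cV[R]_n | norm2 x = 1]].

Definition sqnorm (R : realType) (n : nat) : {mpoly R[n]} :=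
  \sum_(i < n) 'X_i ^+ 2.

(* Multi-indices in [n]^r. Tensors in (R^n)^{(x) r} and matrices in
   R^{[n]^r x [n]^r} are mathcomp matrices, the position of a multi-index
   being its rank in the enumeration of the finite type [idx n r]. *)
Notation idx n r := {ffun 'I_r -> 'I_n}.

Notation tensor R n r := ('cV[R]_#|{: idx n r}|).
Notation tmatrix R n r := ('M[R]_#|{: idx n r}|).

Definition permute_idx (n r : nat) (s : 'S_r) (i : idx n r) : idx n r :=
  [ffun k => i (s k)].

Definition idx_left (n a b r : nat) (e : (a + b)%N = r) (i : idx n r) :
  idx n a := [ffun k => i (cast_ord e (lshift b k))].

Definition idx_right (n a b r : nat) (e : (a + b)%N = r) (i : idx n r) :
  idx n b := [ffun k => i (cast_ord e (rshift a k))].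

(* A \otimes B, the first a tensor legs carrying A and the last b carrying B. *)
Definition kron (R : realType) (n a b r : nat) (e : (a + b)%N = r)
    (A : tmatrix R n a) (B : tmatrix R n b) : tmatrix R n r :=
  \matrix_(i, j)
    (A (enum_rank (idx_left e (enum_val i)))
       (enum_rank (idx_left e (enum_val j))) *
     B (enum_rank (idx_right e (enum_val i)))
       (enum_rank (idx_right e (enum_val j)))).

Definition kronpow (R : realType) (n : nat) (B : 'M[R]_n) (r : nat) :
    tmatrix R n r :=
  \matrix_(i, j) \prod_(k < r)
    B ((enum_val i : idx n r) k) ((enum_val j : idx n r) k).

Definition as_2dtensor (R : realType) (n d : nat) (A : tmatrix R n d)
    (w : idx n (d + d)) : R :=
  A (enum_rank (idx_left erefl w)) (enum_rank (idx_right erefl w)).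

Definition maximally_symmetric (R : realType) (n d : nat)
    (A : tmatrix R n d) : Prop :=
  forall (s : 'S_(d + d)) (w : idx n (d + d)),
    as_2dtensor A (permute_idx s w) = as_2dtensor A w.

Definition trace_inner (R : realType) (m : nat) (A B : 'M[R]_m) : R :=
  \tr (A^T *m B).

Definition is_MaxSym (R : realType) (n d : nat) (f : {mpoly R[n]})
    (A : tmatrix R n d) : Prop :=
  maximally_symmetric A /\
  forall x : 'cV[R]_n, cvmeval f x = trace_inner A (kronpow (x *m x^T) d).

(* The unique matrix satisfying [is_MaxSym] when f is a form of degree 2d. *)
Definition MaxSym (R : realType) (n d : nat) (f : {mpoly R[n]}) :
    tmatrix R n d :=
  xget 0 [set A | is_MaxSym f A].

Definition symmetric_tensor (R : realType) (n r : nat) (v : tensor R n r) :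
    Prop :=
  forall (s : 'S_r) (i : idx n r),
    v (enum_rank (permute_idx s i)) 0 = v (enum_rank i) 0.

Definition is_orthogonal_projection (R : realType) (m : nat)
    (S : set 'cV[R]_m) (P : 'M[R]_m) : Prop :=
  forall v : 'cV[R]_m,
    S (P *m v) /\ forall u, S u -> u^T *m (v - P *m v) = 0.

Definition sym_proj (R : realType) (n r : nat) : tmatrix R n r :=
  xget 0 [set P | is_orthogonal_projection (@symmetric_tensor R n r) P].

Definition psd (R : realType) (m : nat) (A : 'M[R]_m) : Prop :=
  A^T = A /\ forall v : 'cV[R]_m, 0 <= (v^T *m A *m v) 0 0.

Definition lambda_max (R : realType) (m : nat) (A : 'M[R]_m) : R :=
  set_max [set a | eigenvalue A a].

Definition lambda_min (R : realType) (m : nat) (A : 'M[R]_m) : R :=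
  set_min [set a | eigenvalue A a].

Definition lift_sym (R : realType) (n d r : nat) (le_dr : (d <= r)%N)
    (A : tmatrix R n d) : tmatrix R n r :=
  sym_proj R n r *m kron (subnKC le_dr) A (kronpow 1%:M (r - d))
    *m sym_proj R n r.

Definition Qmx (R : realType) (n d : nat) (p : {mpoly R[n]}) : tmatrix R n d :=
  MaxSym d p.

Definition Mmx (R : realType) (n d : nat) : tmatrix R n d :=
  MaxSym d (sqnorm R n ^+ d).

Definition spectral_bound (R : realType) (n d r : nat) (le_dr : (d <= r)%N)
    (p : {mpoly R[n]}) : R :=
  set_max [set nu | psd (lift_sym le_dr (Qmx d p)
                         - nu *: lift_sym le_dr (Mmx R n d))].

Definition gammaQ (R : realType) (n d : nat) (p : {mpoly R[n]}) : R :=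
  Num.max (lambda_max (Qmx d p) - spectral_bound (leqnn d) p)
          (pmin p - lambda_min (Qmx d p)).

Definition alpha_coef (R : realType) (d : nat) : R :=
  2%:R ^+ d / 'C(2 * d, d)%:R.

Definition dim_sym (n d : nat) : nat := 'C(n + d - 1, d).

(* Main.v *)
Require Import Defs.
From mathcomp Require Import all_boot all_order all_algebra all_fingroup.
From mathcomp Require Import all_solvable all_field.
From mathcomp Require Import reals ring lra zify.
From mathcomp Require Import sesquilinear spectral complex.
From mathcomp Require boolp classical_sets mpoly filter topology normedtype derive.

Set Implicit Arguments.
Unset Strict Implicit.
Unset Printing Implicit Defensive.

Import Order.TTheory GRing.Theory Num.Theory.
Local Open Scope ring_scope.

(** Let [f = p - pmin p * (x_1^2 + ... + x_n^2)^d], a nonnegative form, with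
    tensor [gap], and let [eps] be the bound to be proved. It is enough that the
    lift of [gap + eps * M] is nonnegative on symmetric [r]-tensors [v]: then
    [pmin p - eps] competes in the maximum that defines the spectral bound
    ([spectral_gap_bound]). The lifted form at [v] is the pairing of [gap] with
    the partial trace [rho] of [v v^T] over the last [r - d] legs ([reduced]).

    The heart is a de Finetti argument: up to a small error, [rho] is a mixture of
    product states. Let [z] be uniform on the complex unit sphere, let [V] and [w]
    be the contractions of [v] with the [r]-th and the [(r-d)]-th power of the
    conjugate of [z], let [P] be the projection onto the [d]-th power of [z], and
    let [c = dim S^(r-d) / dim S^r]. After normalization the mean of [w w*] is
    [rho] and, because [P w] is [V] times the power of [z], the mean of [P w w*]
    is [c rho]. Hence the mean of [(w - P w)(w - P w)*], which is positive of
    trace [(1 - c) |v|^2], equals [(1 - 2 c) rho] plus a positive mixture of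
    product states ([expect_residue]). The tensor [gap] is nonnegative on that
    mixture: by maximal symmetry, [f(z + conj z)] averaged over the phase of [z]
    is a positive multiple of the value of [gap] at the product state of [z]
    ([expect_form_ge0]). If the quadratic form of [gap] lies between [-K2] and
    [K1] on symmetric [d]-tensors, it follows that the pairing with [rho] is at
    least [-(1 - c) (K1 + 2 K2) |v|^2], and [1 - c <= d (n-1) / (r+1)]
    ([de_finetti_real]).

    No integral occurs. The sphere is replaced by homogeneous moments of a
    standard complex Gaussian vector, the degrees being matched by powers of
    [|z|^2] ([expect_sqn]), and the Gaussian by a finite positive quadrature that
    is exact up to any prescribed degree. It is read off the spectral
    decomposition of the Jacobi matrix of the Laguerre polynomials, combined with
    roots of unity for the phase ([moment_rule_exists]).

    Two facts on [M] turn this into the stated constant. It is the symmetrization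
    of the projection onto symmetric tensors, whose squared Frobenius norm is
    [N = dim_sym n d], so [M <= sqrt N] ([sqnorm_tensor_upper]). It is also a
    multiple of the Gaussian moment tensor, and keeping the top chaos in the
    Hermite expansion of a form of degree [d] gives [alpha_coef R d <= M] on
    symmetric tensors ([sqnorm_tensor_lower]). Consequently [K2 = gamma sqrt N]
    and [K1 = gamma + |pmin p| sqrt N] are admissible. If [n] and [d] exceed [1]
    then [0] is an eigenvalue of [Q(p)], whence [|pmin p| <= gamma]
    ([pmin_le_gamma]) and [K1 + 2 K2 <= 4 gamma sqrt N]. If [d = 1] then [gap] is
    a positive semidefinite matrix, and if [n = 1] then [1 - c = 0]. *)

(** * Words, their letter counts, and monomials *)

Notation expo n := {ffun 'I_n -> nat}.

Definition cnt (n r : nat) (w : idx n r) : expo n :=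
  [ffun l => \sum_(k < r) (w k == l)]%N.

Definition inc (n : nat) (l : 'I_n) (a : expo n) : expo n :=
  [ffun k => (k == l) + a k]%N.

Definition addx (n : nat) (a b : expo n) : expo n := [ffun k => a k + b k]%N.

Definition expo0 (n : nat) : expo n := [ffun => 0%N].

Definition deg (n : nat) (a : expo n) : nat := (\sum_l a l)%N.

Definition mon (R : comNzRingType) (n r : nat) (x : 'I_n -> R) (w : idx n r) : R :=
  \prod_k x (w k).

Definition monx (R : comNzRingType) (n : nat) (x : 'I_n -> R) (a : expo n) : R :=
  \prod_l x l ^+ a l.

Definition cons_word (n r : nat) (l : 'I_n) (w : idx n r) : idx n r.+1 :=
  [ffun k => oapp w l (unlift ord0 k)].

Definition join_word (n a b r : nat) (e : (a + b)%N = r) (i : idx n a) (k : idx n b) :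
    idx n r :=
  [ffun s => match split (cast_ord (esym e) s) with inl s => i s | inr s => k s end].

Section Words.
Variable n : nat.

Lemma deg_cnt r (w : idx n r) : deg (cnt w) = r.
Proof.
rewrite /deg; under eq_bigr do rewrite ffunE.
rewrite exchange_big /= -[RHS]card_ord -sum1_card; apply: eq_bigr => k _.
by rewrite (bigD1 (w k)) //= eqxx big1 ?addn0 // => l; rewrite eq_sym => /negPf->.
Qed.

Lemma monE (R : comNzRingType) r (x : 'I_n -> R) (w : idx n r) :
  mon x w = monx x (cnt w).
Proof.
rewrite /mon /monx; under [RHS]eq_bigr => l _.
  rewrite ffunE -prodrXr; over.
rewrite exchange_big /=; apply: eq_bigr => k _.
rewrite (bigD1 (w k)) //= eqxx big1 ?mulr1 // => l.
by rewrite eq_sym => /negPf->.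
Qed.

Lemma cnt_cons r l (w : idx n r) : cnt (cons_word l w) = inc l (cnt w).
Proof.
apply/ffunP => k; rewrite !ffunE big_ord_recl ffunE unlift_none /= eq_sym.
by congr (_ + _)%N; apply: eq_bigr => s _; rewrite ffunE liftK.
Qed.

Lemma mon_cons (R : comNzRingType) r (x : 'I_n -> R) l (w : idx n r) :
  mon x (cons_word l w) = x l * mon x w.
Proof.
rewrite /mon big_ord_recl ffunE unlift_none /=; congr (_ * _).
by apply: eq_bigr => s _; rewrite ffunE liftK.
Qed.

Lemma sum_cons (V : nmodType) r (G : idx n r.+1 -> V) :
  \sum_w G w = \sum_l \sum_w G (cons_word l w).
Proof.
rewrite pair_bigA /=.
pose g (w : idx n r.+1) := (w ord0, [ffun k => w (lift ord0 k)] : idx n r).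
rewrite (reindex (fun p => cons_word p.1 p.2)) //=; exists g => [[l w]|w] _ /=.
  congr pair; first by rewrite ffunE unlift_none.
  by apply/ffunP => k; rewrite !ffunE liftK.
apply/ffunP => k; rewrite !ffunE; case: unliftP => [j ->|->] //=.
by rewrite ffunE.
Qed.

Lemma sum_word0 (V : nmodType) (G : idx n 0 -> V) (w : idx n 0) :
  \sum_w G w = G w.
Proof.
rewrite (big_pred1 w) // => u; apply/esym/eqP/ffunP => -[] //.
Qed.

Lemma cnt_word0 (w : idx n 0) : cnt w = expo0 n.
Proof. by apply/ffunP => k; rewrite !ffunE big_ord0. Qed.

Lemma join_word_left a b r (e : (a + b)%N = r) i k :
  idx_left e (join_word e i k) = i :> idx n a.
Proof. by apply/ffunP => s; rewrite !ffunE cast_ordK (unsplitK (inl s)). Qed.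

Lemma join_word_right a b r (e : (a + b)%N = r) i k :
  idx_right e (join_word e i k) = k :> idx n b.
Proof. by apply/ffunP => s; rewrite !ffunE cast_ordK (unsplitK (inr s)). Qed.

Lemma join_wordK a b r (e : (a + b)%N = r) (w : idx n r) :
  join_word e (idx_left e w) (idx_right e w) = w.
Proof.
apply/ffunP => s; rewrite !ffunE.
by case: splitP => j ej; rewrite ffunE; congr (w _); apply/val_inj; rewrite /= -ej.
Qed.

Lemma sum_join (V : nmodType) a b r (e : (a + b)%N = r) (G : idx n r -> V) :
  \sum_w G w = \sum_i \sum_k G (join_word e i k).
Proof.
rewrite pair_bigA /= (reindex (fun p => join_word e p.1 p.2)) //=.
exists (fun w => (idx_left e w, idx_right e w)) => [[i k]|w] _ /=.
  by rewrite join_word_left join_word_right.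
exact: join_wordK.
Qed.

Lemma prod_join (R : comNzRingType) a b r (e : (a + b)%N = r) (F : 'I_r -> 'I_n -> R)
   (i : idx n a) (k : idx n b) :
  \prod_s F s (join_word e i k s) = (\prod_s F (cast_ord e (lshift b s)) (i s)) *
     \prod_s F (cast_ord e (rshift a s)) (k s).
Proof.
rewrite (reindex (cast_ord e)) /=; last first.
  by exists (cast_ord (esym e)) => s _; rewrite ?cast_ordK ?cast_ordKV.
rewrite big_split_ord /=; congr (_ * _); apply: eq_bigr => s _; rewrite ffunE cast_ordK.
  by rewrite (unsplitK (inl s)).
by rewrite (unsplitK (inr s)).
Qed.

Lemma mon_join (R : comNzRingType) a b r (e : (a + b)%N = r) (x : 'I_n -> R)
   (i : idx n a) (k : idx n b) :
  mon x (join_word e i k) = mon x i * mon x k.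
Proof. exact: (prod_join e (fun _ => x)). Qed.

Lemma cnt_join a b r (e : (a + b)%N = r) (i : idx n a) (k : idx n b) :
  cnt (join_word e i k) = addx (cnt i) (cnt k).
Proof.
apply/ffunP => l; rewrite !ffunE.
rewrite (reindex (cast_ord e)) /=; last first.
  by exists (cast_ord (esym e)) => s _; rewrite ?cast_ordK ?cast_ordKV.
rewrite big_split_ord /=; congr (_ + _)%N; apply: eq_bigr => s _; rewrite ffunE cast_ordK.
  by rewrite (unsplitK (inl s)).
by rewrite (unsplitK (inr s)).
Qed.

Lemma cnt_permute r (s : 'S_r) (w : idx n r) : cnt (permute_idx s w) = cnt w.
Proof.
apply/ffunP => l; rewrite !ffunE [RHS](reindex_inj (@perm_inj _ s)).
by apply: eq_bigr => k _; rewrite ffunE.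
Qed.

(** The words with given letter counts form one orbit of the symmetric group; this
    lets invariance under permutation of positions be stated through [cnt]. *)
Lemma cnt_eq_permute r (w u : idx n r) :
  cnt w = cnt u -> exists s, u = permute_idx s w.
Proof.
move=> /ffunP e.
have ct (v : idx n r) l : count_mem l [tuple v k | k < r] = cnt v l.
  rewrite /= count_map ffunE -sum1_count big_enum_cond big_mkcond /=.
  by apply: eq_bigr => k _; case: eqP.
have /tuple_permP[s es] : perm_eq [tuple u k | k < r] [tuple w k | k < r].
  by apply/allP => l _ /=; apply/eqP; rewrite !ct e.
exists s; apply/ffunP => k; rewrite ffunE.
have := congr1 (fun t : seq 'I_n => nth (w k) t k) es.
have sz (v : 'I_r -> 'I_n) : nth (w k) [tuple v k | k < r] k = v k.
  by rewrite -tnth_nth tnth_mktuple.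
by rewrite !sz tnth_mktuple.
Qed.

End Words.

(** * The Wick kernel *)

Definition fact_expo (n : nat) (a : expo n) : nat := (\prod_l (a l)`!)%N.

(** The moment of [z^a] against the conjugate of [z^b] for a vector [z] of independent
    standard complex Gaussians. *)
Definition wick_expo (n : nat) (a b : expo n) : nat := if a == b then fact_expo a else 0%N.

Definition wick (n r : nat) (i j : idx n r) : nat := wick_expo (cnt i) (cnt j).

Definition dec (n : nat) (l : 'I_n) (a : expo n) : expo n :=
  [ffun k => a k - (k == l)]%N.

(** For words this is the invariance under permutation of positions, by
    [cnt_eq_permute]; dependence on [cnt] alone is what sums over words use. *)
Definition count_sym (T : Type) (n r : nat) (v : idx n r -> T) : Prop :=
  forall i j, cnt i = cnt j -> v i = v j.

Section Wick.
Variable n : nat.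
Implicit Types a b : expo n.

Lemma fact_expo0 : fact_expo (expo0 n) = 1%N.
Proof. by rewrite /fact_expo big1 // => l _; rewrite ffunE. Qed.

Lemma fact_expo_inc l a : fact_expo (inc l a) = ((a l).+1 * fact_expo a)%N.
Proof.
rewrite /fact_expo (bigD1 l) //= [in RHS](bigD1 l) //= ffunE eqxx factS mulnA.
congr (_ * _)%N; apply: eq_bigr => k /negPf nkl; by rewrite ffunE nkl.
Qed.

Lemma fact_expo_gt0 a : (0 < fact_expo a)%N.
Proof. by apply: prodn_gt0 => l; apply: fact_gt0. Qed.

Lemma inc_inj l : injective (@inc n l).
Proof.
by move=> a b /ffunP e; apply/ffunP => k; have := e k; rewrite !ffunE => /addnI.
Qed.

Lemma inc_dec l a : (0 < a l)%N -> inc l (dec l a) = a.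
Proof.
move=> al; apply/ffunP => k; rewrite !ffunE.
by case: eqP => [->|_] /=; rewrite ?add0n ?subn0 // add1n subn1 prednK.
Qed.

Lemma dec_inc l a : dec l (inc l a) = a.
Proof. by apply/ffunP => k; rewrite !ffunE addnC addnK. Qed.

Lemma deg_inc l a : deg (inc l a) = (deg a).+1.
Proof.
rewrite /deg; under eq_bigr do rewrite ffunE.
rewrite big_split /= (bigD1 l) //= eqxx big1 ?addn0 ?add1n // => k.
by move/negPf->.
Qed.

Lemma deg_addx a b : deg (addx a b) = (deg a + deg b)%N.
Proof. by rewrite /deg -big_split; apply: eq_bigr => l _; rewrite ffunE. Qed.

Lemma leq_deg a l : (a l <= deg a)%N.
Proof. by rewrite /deg (bigD1 l) //= leq_addr. Qed.

Lemma wick_expoC a b : wick_expo a b = wick_expo b a.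
Proof. by rewrite /wick_expo eq_sym; case: eqP => // ->. Qed.

Lemma wick_expo_inc l a b : wick_expo (inc l a) b = (b l * wick_expo a (dec l b))%N.
Proof.
case: (posnP (b l)) => [b0|bl].
  rewrite b0 /wick_expo; case: eqP => // e.
  by move: b0; rewrite -e ffunE eqxx.
rewrite -{1}(inc_dec bl) /wick_expo (inj_eq (@inc_inj l)); case: eqP => [->|];
  last by rewrite muln0.
rewrite fact_expo_inc ffunE eqxx subn1 prednK //.
Qed.

Lemma wickC r (i j : idx n r) : wick i j = wick j i.
Proof. exact: wick_expoC. Qed.

(** The multinomial formula: removing the first letter [l] of a word lowers the
    exponent of [l] in [a] and leaves a factor [a l]. *)
Lemma sum_wick_expo r a : deg a = r ->
  (\sum_(K : idx n r) wick_expo (cnt K) a = r`!)%N.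
Proof.
elim: r a => [|r IH] a da.
  have w : idx n 0 by apply: finfun => -[].
  rewrite (sum_word0 _ w) cnt_word0.
  suff -> : a = expo0 n by rewrite /wick_expo eqxx fact_expo0.
  apply/ffunP => l; rewrite ffunE; apply/eqP; rewrite -leqn0 -da; exact: leq_deg.
rewrite (sum_cons (fun K => wick_expo (cnt K) a)).
transitivity (\sum_l a l * r`!)%N; last by rewrite -big_distrl /= -/(deg a) da.
apply: eq_bigr => l _; case: (posnP (a l)) => [a0|al].
  by rewrite a0 mul0n big1 // => w _; rewrite cnt_cons wick_expo_inc a0.
rewrite -(IH (dec l a)); first by rewrite big_distrr; apply: eq_bigr => w _;
  rewrite cnt_cons wick_expo_inc.
by apply: succn_inj; rewrite -(deg_inc l) inc_dec.
Qed.

(** Up to [r!] the Wick kernel is the orthogonal projection onto symmetric tensors. *)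
Lemma wick_sym (R : comNzRingType) r (v : idx n r -> R) I :
  count_sym v -> \sum_K (wick K I)%:R * v K = r`!%:R * v I.
Proof.
move=> vs; rewrite -(sum_wick_expo (deg_cnt I)) natr_sum mulr_suml.
apply: eq_bigr => K _; rewrite /wick /wick_expo; case: eqP => [e|]; last by rewrite !mul0r.
by rewrite (vs K I).
Qed.

Lemma wick_count_sym r (I : idx n r) : count_sym (fun K => wick K I).
Proof. by move=> K K' e; rewrite /wick e. Qed.

(** Up to [r!] this is the trace of that projection, that is, the dimension of the
    space of symmetric tensors. *)
Lemma sum_fact_expo r :
  (\sum_(K : idx n r) fact_expo (cnt K) = \prod_(s < r) (n + s))%N.
Proof.
elim: r => [|r IH].
  have w : idx n 0 by apply: finfun => -[].
  by rewrite (sum_word0 _ w) cnt_word0 fact_expo0 big_ord0.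
rewrite (sum_cons (fun K =>
  fact_expo (cnt K))) big_ord_recr /= -IH exchange_big /= big_distrl /=.
apply: eq_bigr => w _; under eq_bigr do rewrite cnt_cons fact_expo_inc -addn1.
rewrite -big_distrl mulnC big_split /= sum1_card card_ord addnC.
by rewrite -/(deg (cnt w)) deg_cnt.
Qed.

End Wick.

(** * Real Gaussian moments *)

(** Moments of a centred real Gaussian of variance [2], for which the even ones
    [(2k)! / k!] are integers. *)
Fixpoint gauss_moment (c : nat) : nat :=
  match c with 0 => 1 | 1 => 0 | (c'.+1 as c1).+1 => 2 * c1 * gauss_moment c' end%N.
Arguments gauss_moment : simpl never.

Definition gauss_expo (n : nat) (a : expo n) : nat := (\prod_l gauss_moment (a l))%N.

Definition word_sum (R : comNzRingType) (n N : nat) (phi : expo n -> R) (x : 'I_n -> R) : R :=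
  \sum_(w : idx n N) phi (cnt w) * mon x w.

Section Gaussian.
Variables (R : comNzRingType) (n : nat).
Implicit Types (phi psi : expo n -> R) (x : 'I_n -> R).

Lemma mon0 x (w : idx n 0) : mon x w = 1.
Proof. by rewrite /mon big_ord0. Qed.

Lemma word_sum0 phi x : word_sum 0 phi x = phi (expo0 n).
Proof.
have w : idx n 0 by apply: finfun => -[].
by rewrite /word_sum (sum_word0 _ w) cnt_word0 mon0 mulr1.
Qed.

Lemma word_sumS N phi x :
  word_sum N.+1 phi x = \sum_l x l * word_sum N (fun a => phi (inc l a)) x.
Proof.
rewrite /word_sum sum_cons; apply: eq_bigr => l _; rewrite mulr_sumr.
by apply: eq_bigr => w _; rewrite cnt_cons mon_cons mulrCA.
Qed.

(** Euler's rule: any of the [N] positions may carry the letter [l] that is removed. *)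
Lemma word_sum_deriv N psi x l :
  word_sum N (fun a => (a l)%:R * psi (dec l a)) x = N%:R * x l * word_sum N.-1 psi x.
Proof.
elim: N psi => [|N IH] psi; first by rewrite word_sum0 ffunE !mul0r.
have e (k : 'I_n) : word_sum N (fun a => (inc k a l)%:R * psi (dec l (inc k a))) x =
   (l == k)%:R * word_sum N psi x + N%:R * x l * word_sum N.-1 (fun a => psi (inc k a)) x.
  rewrite -IH /word_sum mulr_sumr -big_split /=; apply: eq_bigr => w _.
  rewrite ffunE natrD mulrDl mulrDl mulrA; congr (_ + _).
    by case: eqP => [->|]; rewrite ?mul0r // dec_inc.
  case: (posnP (cnt w l)) => [->|wl]; first by rewrite !mul0r.
  congr (_ * psi _ * _); apply/ffunP => s; rewrite !ffunE.
  by case: (s =P l) => [->|]; rewrite ?subn0 //; rewrite ffunE in wl; rewrite addnBA.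
rewrite word_sumS /=; under eq_bigr => k _ do rewrite e mulrDr.
rewrite big_split /= (bigD1 l) //= eqxx mul1r big1 ?addr0; last first.
  by move=> k; rewrite eq_sym => /negPf->; rewrite mul0r mulr0.
rewrite -addn1 natrD !mulrDl mul1r addrC; congr (_ + _).
case: N {IH e} => [|N]; first by rewrite !mul0r big1 // => k _; rewrite !mul0r mulr0.
rewrite [in RHS]word_sumS mulr_sumr; apply: eq_bigr => k _; by rewrite mulrCA.
Qed.

Lemma gauss_moment_rec c : gauss_moment c.+1 = (2 * c * gauss_moment c.-1)%N.
Proof. by case: c. Qed.

Lemma gauss_expo_inc l (a : expo n) :
  gauss_expo (inc l a) = (2 * a l * gauss_expo (dec l a))%N.
Proof.
rewrite /gauss_expo (bigD1 l) //= [in RHS](bigD1 l) //= !ffunE eqxx mulnA add1n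
  gauss_moment_rec subn1.
congr (_ * _)%N; apply: eq_bigr => k /negPf nkl; by rewrite !ffunE nkl subn0.
Qed.

(** Rotation invariance of the Gaussian measure: the moment of the [2d]-th power of a
    linear form depends on its length only. The integration by parts
    [gauss_expo_inc] turns it into a recursion on [d]. *)
Lemma word_sum_gauss d x :
  word_sum (d + d) (fun a => (gauss_expo a)%:R) x =
    (gauss_moment (d + d))%:R * (\sum_l x l ^+ 2) ^+ d.
Proof.
elim: d => [|d IH].
  by rewrite word_sum0 expr0 mulr1 /gauss_expo big1 // => l _; rewrite ffunE.
rewrite addSn addnS word_sumS.
transitivity (\sum_l x l ^+ 2 * (2 * (d + d).+1 * gauss_moment (d + d))%:R * (\sum_l x l ^+
  2) ^+ d).
  apply: eq_bigr => l _.
  transitivity (x l * (2%:R * word_sum (d + d).+1 (fun a : expo n =>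
    (a l)%:R * (gauss_expo (dec l a))%:R) x)).
    congr (_ * _); rewrite /word_sum mulr_sumr; apply: eq_bigr => w _.
    by rewrite gauss_expo_inc !natrM !mulrA.
  rewrite (word_sum_deriv _ (fun a => (gauss_expo a)%:R)) /= IH !natrM; ring.
by rewrite -!mulr_suml exprS mulrA; congr (_ * _); rewrite mulrC.
Qed.

End Gaussian.

(** The mean of the [k]-th derivative of [x^a], that is, up to normalization, the
    coefficient of the [k]-th Hermite polynomial in the expansion of [x^a]. *)
Definition hermite_coef (k a : nat) : nat := (a ^_ k * gauss_moment (a - k))%N.

Lemma hermite_coefS k a :
  hermite_coef k a.+1 = (2 * hermite_coef k.+1 a + k * hermite_coef k.-1 a)%N.
Proof.
rewrite /hermite_coef; case: k => [|k] /=.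
  by rewrite !ffactn0 mul0n addn0 !mul1n ?subn0 ffactn1 gauss_moment_rec subn1; lia.
rewrite subSS.
have -> : (a.+1 ^_ k.+1 = a ^_ k.+1 + k.+1 * a ^_ k)%N.
  by rewrite ffactSS ffactnSr; case: (leqP k a) => h; [nia|rewrite !ffact_small //; lia].
case: (ltnP k a) => h; last by rewrite (ffact_small (n := a)) // (ffact_small (n :=
  a) (m := k.+2)) //; lia.
rewrite (ffactnSr a k.+1).
have -> : (a - k = (a - k.+1).+1)%N by lia.
rewrite gauss_moment_rec.
have -> : ((a - k.+1).-1 = a - k.+2)%N by lia.
set f := (a ^_ k.+1)%N; set g := (a ^_ k)%N; set y := (gauss_moment _); set z := (a - k.+1)%N.
nia.
Qed.

Lemma hermite_coef_gt k a : (a < k)%N -> hermite_coef k a = 0%N.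
Proof. by move=> h; rewrite /hermite_coef ffact_small. Qed.

Lemma hermite_coef_diag a : hermite_coef a a = a`!.
Proof. by rewrite /hermite_coef ffactnn subnn muln1. Qed.

(** Parseval's identity for [x^a] and [x^b] in the Hermite basis. Multiplication by [x]
    acts symmetrically through [hermite_coefS], so the right-hand side depends on
    [a + b] only and may be computed at [a = 0]. *)
Lemma gauss_moment_split (R : numFieldType) K a b : (a + b < K)%N ->
  (gauss_moment (a + b))%:R =
    \sum_(k < K) (2 ^+ k / k`!%:R) * (hermite_coef k a)%:R * (hermite_coef k b)%:R :> R.
Proof.
elim: a b => [|a IH] b.
  rewrite add0n; case: K => // K _; rewrite big_ord_recl big1.
    by rewrite /hermite_coef !ffactn0 ?subn0 expr0 fact0 divr1 !mul1n !mul1r addr0.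
  by move=> k _; rewrite hermite_coef_gt ?mulr0 ?mul0r.
move=> h; have h' : (a + b.+1 < K)%N by rewrite addnS.
rewrite addSnnS IH //.
case: K {IH} h h' => // K h h'.
pose S (a b : nat) : R :=
  \sum_(k < K.+1) (2 ^+ k.+1 / k`!%:R) * (hermite_coef k.+1 a)%:R * (hermite_coef k b)%:R.
have key x y : (x <= K)%N -> (y <= K)%N ->
  \sum_(k < K.+1) (2 ^+ k / k`!%:R) * (hermite_coef k x.+1)%:R * (hermite_coef k y)%:R =
    S x y + S y x :> R.
  move=> hx hy.
  transitivity (S x y + \sum_(k < K.+1) (2 ^+ k / k`!%:R) * (k * hermite_coef k.-1 x)%:R *
    (hermite_coef k y)%:R).
    rewrite /S -big_split /=; apply: eq_bigr => k _.
    by rewrite hermite_coefS natrD natrM exprS; ring.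
  congr (_ + _).
  rewrite /S big_ord_recl mul0n mulr0 mul0r add0r big_ord_recr /= (hermite_coef_gt (k :=
    K.+1)) // mulr0 mul0r addr0.
  apply: eq_bigr => k _; rewrite /bump /= add1n natrM factS natrM invfM.
  have k0 : 1 + (k%:R : R) != 0 by rewrite addrC natr1 pnatr_eq0.
  by field; rewrite k0 pnatr_eq0 -lt0n fact_gt0.
rewrite [RHS]key; [|lia|lia].
rewrite addrC -key; [|lia|lia].
by apply: eq_bigr => k _; rewrite mulrAC.
Qed.

Section MomentLower.
Variables (R : realFieldType) (n d : nat) (v : idx n d -> R).

(** The larger side is the Gaussian mean of the square of the form [v(x)]. By the
    Parseval identity each component in the tensor Hermite basis contributes a
    nonnegative square; those of total degree [d] see only the leading coefficients, and give
    exactly [2^d d!] times the squared norm of [v]. *)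
Lemma gauss_form_lower : count_sym v ->
  (2 ^ d * d`!)%:R * \sum_i v i ^+ 2 <=
  \sum_i \sum_j (gauss_expo (addx (cnt i) (cnt j)))%:R * v i * v j.
Proof.
move=> vs; pose K := (d + d).+1.
pose ex (k : {ffun 'I_n -> 'I_K}) : expo n := [ffun l => k l : nat].
pose c (k : {ffun 'I_n -> 'I_K}) : R := \prod_l (2 ^+ k l / (k l)`!%:R).
pose h (k : {ffun 'I_n -> 'I_K}) (i : idx n d) : R := \prod_l (hermite_coef (k l) (cnt i l))%:R.
have e i j : (gauss_expo (addx (cnt i) (cnt j)))%:R = \sum_k c k * h k i * h k j :> R.
  rewrite /gauss_expo natr_prod.
  have bnd l : (cnt i l + cnt j l < K)%N.
    by rewrite ltnS; apply: leq_add; [rewrite -{2}(deg_cnt i)|rewrite -{2}(deg_cnt j)];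
      apply: leq_deg.
  under eq_bigr => l _ do rewrite ffunE (gauss_moment_split R (bnd l)).
  rewrite bigA_distr_bigA /=; apply: eq_bigr => k _.
  by rewrite big_split big_split /= -!mulrA.
have -> : \sum_i \sum_j (gauss_expo (addx (cnt i) (cnt j)))%:R * v i * v j =
   \sum_k c k * (\sum_i h k i * v i) ^+ 2.
  under eq_bigr do under eq_bigr do rewrite e !mulr_suml.
  under eq_bigr do rewrite exchange_big /=.
  rewrite exchange_big /=; apply: eq_bigr => k _.
  rewrite expr2 mulr_suml mulr_sumr; apply: eq_bigr => i _.
  rewrite !mulr_sumr; apply: eq_bigr => j _; ring.
have c0 k : 0 <= c k by apply: prodr_ge0 => l _; rewrite divr_ge0 ?exprn_ge0 ?ler0n.
rewrite (bigID (fun k => deg (ex k) == d)) /= -[leLHS]addr0 lerD //; last first.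
  by apply: sumr_ge0 => k _; rewrite mulr_ge0 // sqr_ge0.
have h_wick k i : deg (ex k) == d -> h k i = (wick_expo (cnt i) (ex k))%:R.
  move=> /eqP dk; rewrite /wick_expo; case: eqP => [ei|ne].
    rewrite /h /fact_expo natr_prod; apply: eq_bigr => l _.
    have -> : (k l : nat) = cnt i l by rewrite ei ffunE.
    by rewrite hermite_coef_diag.
  have [l hl] : exists l, (cnt i l < k l)%N.
    apply/existsP; apply: contra_notT ne; rewrite negb_exists => /forallP le.
    have le' l : (ex k l <= cnt i l)%N by rewrite ffunE leqNgt le.
    apply/ffunP => l; apply/eqP; rewrite eqn_leq le' andbT.
    have := etrans (deg_cnt i) (esym dk); rewrite /deg (bigD1 l) //= [RHS](bigD1 l) //= => ee.
    have : (\sum_(i0 < n | i0 != l) ex k i0 <= \sum_(i0 < n | i0 != l) cnt i i0)%N.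
      by apply: leq_sum => s _; apply: le'.
    move: ee; move: (bigop _ _ _) (bigop _ _ _) (cnt i l) (ex k l) => A B x y; lia.
  by rewrite /h (bigD1 l) //= hermite_coef_gt // mul0r.
have cE k : deg (ex k) == d -> c k = 2 ^+ d / (fact_expo (ex k))%:R.
  move=> /eqP dk; rewrite /c big_split /= prodfV; congr (_ / _).
    rewrite -[in RHS]dk /deg -prodrXr; apply: eq_bigr => l _; by rewrite ffunE.
  by rewrite /fact_expo natr_prod; apply: eq_bigr => l _; rewrite ffunE.
rewrite natrM natrX -mulrA.
have fin (i j : idx n d) : (wick i j)%:R =
   \sum_(k | deg (ex k) == d) (wick_expo (cnt i) (ex k))%:R * (wick_expo (cnt j) (ex k))%:R
     / (fact_expo (ex k))%:R :> R.
  have cK l : (cnt j l < K)%N.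
    by rewrite ltnS; apply: leq_trans (leq_deg _ l) _; rewrite deg_cnt leq_addr.
  pose kj : {ffun 'I_n -> 'I_K} := [ffun l => Ordinal (cK l)].
  have ekj : ex kj = cnt j by apply/ffunP => l; rewrite !ffunE.
  rewrite (bigD1 kj) /=; last by rewrite ekj deg_cnt.
  rewrite big1 ?addr0; last first.
    move=> k /andP[_ nk]; rewrite {2}/wick_expo; case: eqP => [ejk|];
      last by rewrite mulr0 mul0r.
    by case/eqP: nk; apply/ffunP => l; apply/val_inj; rewrite [RHS]/= ffunE /= ejk ffunE.
  rewrite ekj {2}/wick_expo eqxx -mulrA divff ?mulr1 // pnatr_eq0 -lt0n; exact: fact_expo_gt0.
have -> : d`!%:R * \sum_i v i ^+ 2 = \sum_i \sum_j (wick i j)%:R * v i * v j.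
  rewrite mulr_sumr exchange_big /=; apply: eq_bigr => j _.
  by rewrite -mulr_suml wick_sym // expr2 mulrA.
rewrite le_eqVlt; apply/orP; left; apply/eqP.
under [X in _ * X = _]eq_bigr do under eq_bigr do rewrite fin !mulr_suml.
under [X in _ * X = _]eq_bigr do rewrite exchange_big /=.
rewrite exchange_big mulr_sumr /=; apply: eq_bigr => k dk.
rewrite cE // expr2 mulr_suml !mulr_sumr; apply: eq_bigr => i _.
rewrite !mulr_sumr; apply: eq_bigr => j _; rewrite !h_wick //; ring.
Qed.

End MomentLower.

(** * A positive quadrature for complex Gaussian moments *)

Section Quadrature.
Local Open Scope sesquilinear_scope.
Variable C : numClosedFieldType.

Lemma prim_root_exists n : (0 < n)%N -> exists z : C, n.-primitive_root z.
Proof.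
move=> n_gt0; have [rs def_p] := closed_field_poly_normal ('X^n - 1 : {poly C}).
rewrite (monicP (monicXnsubC _ n_gt0)) scale1r in def_p.
suff /hasP[z _ zn] : has n.-primitive_root rs by exists z.
apply: has_prim_root => //.
- by apply/allP => z; rewrite -root_prod_XsubC -def_p.
- by rewrite -separable_prod_XsubC -def_p separable_Xn_sub_1 // pnatr_eq0 -lt0n.
- by rewrite -ltnS -(size_prod_XsubC rs id) -def_p size_XnsubC.
Qed.

Lemma sum_prim_root K (z : C) a b : K.-primitive_root z -> (a < K)%N -> (b < K)%N ->
  \sum_(t < K) (z ^+ t) ^+ a * ((z ^+ t) ^+ b)^* = K%:R * (a == b)%:R.
Proof.
move=> zK aK bK; have z1 : z * z^* = 1.
  have Kn := prim_order_gt0 zK.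
  rewrite -normCK; suff -> : `|z| = 1 by rewrite expr1n.
  by apply/eqP; rewrite -(@pexpr_eq1 _ _ K) // -?lt0n // -normrX (prim_expr_order zK) normr1.
pose q := z ^+ a * (z^*) ^+ b.
have -> : \sum_(t < K) (z ^+ t) ^+ a * ((z ^+ t) ^+ b)^* = \sum_(t < K) q ^+ t.
  by apply: eq_bigr => t _; rewrite /q exprMn -!exprM rmorphXn /= mulnC (mulnC b).
have qz : q * z ^+ b = z ^+ a by rewrite /q -mulrA -exprMn (mulrC _ z) z1 expr1n mulr1.
have [ab|ab] := eqVneq a b.
  have -> : q = 1 by rewrite /q -ab -exprMn z1 expr1n.
  by under eq_bigr do rewrite expr1n; rewrite sumr_const card_ord mulr1.
rewrite mulr0; have qK : q ^+ K = 1.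
  rewrite /q exprMn -!exprM mulnC exprM (prim_expr_order zK) expr1n mul1r mulnC exprM.
  by rewrite -rmorphXn /= (prim_expr_order zK) rmorph1 expr1n.
have q1 : q - 1 != 0.
  rewrite subr_eq0; apply: contra_neq ab => q1.
  have /eqP := qz; rewrite q1 mul1r (eq_prim_root_expr zK) !modn_small // => /eqP.
  by move=> /esym.
by apply: (mulfI q1); rewrite mulr0 -subrX1 qK subrr.
Qed.

(** The spectral theorem in coordinates, together with the consequences for powers,
    diagonal entries and eigenvectors that are used below. *)
Lemma hermitian_spectrum m (A : 'M[C]_m) : A \is hermsymmx ->
  exists (P : 'M[C]_m) (D : 'I_m -> C),
  [/\ forall i j, \sum_s (P s i)^* * P s j = (i == j)%:R,
      forall s, D s \is Num.real,
      forall s, D s = \sum_i \sum_j P s i * A i j * (P s j)^*,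
      forall s, exists2 u : 'rV[C]_m, u != 0 & u *m A = D s *: u &
      forall k i j, (A ^+ k) i j = \sum_s (P s i)^* * D s ^+ k * P s j].
Proof.
move=> hA; pose P := spectralmx A; pose D := spectral_diag A.
have Pu : P \is unitarymx := spectral_unitarymx A.
have PPt := unitarymxP Pu; have PtP := mulmx1C PPt.
have /orthomx_spectralP eA := hermitian_normalmx hA.
rewrite -/P -/D invmx_unitary // in eA.
have PA : P *m A = diag_mx D *m P by rewrite [in LHS]eA !mulmxA PPt mul1mx.
exists P, (fun s => D 0 s); split.
- move=> i j; have /matrixP/(_ i j) := PtP; rewrite !mxE => <-.
  by apply: eq_bigr => s _; rewrite !mxE.
- by move=> s; apply: (mxOverP (hermitian_spectral_diag_real hA)).
- move=> s; have /matrixP/(_ s s) : P *m A *m P ^t* = diag_mx D.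
    by rewrite PA -mulmxA PPt mulmx1.
  rewrite mxE [RHS]mxE eqxx mulr1n => <-; rewrite exchange_big /=.
  by apply: eq_bigr => j _; rewrite mxE mulr_suml; apply: eq_bigr => i _; rewrite !mxE.
- move=> s; exists (row s P); last first.
    by rewrite -row_mul PA mul_diag_mx; apply/rowP => j; rewrite !mxE.
  apply: contraTneq isT => r0; have /matrixP/(_ s s) := PPt.
  rewrite mxE mxE eqxx big1 => [/esym/eqP|j _]; first by rewrite oner_eq0.
  by have /rowP/(_ j) := r0; rewrite !mxE => ->; rewrite mul0r.
- move=> k i j; have -> : A ^+ k = P ^t* *m diag_mx (\row_s D 0 s ^+ k) *m P.
    elim: k => [|k IH].
      rewrite expr0 (_ : diag_mx _ = 1%:M) ?mulmx1 ?PtP //.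
      by apply/matrixP => s t; rewrite !mxE expr0.
    rewrite exprSr IH -!mulmxE; rewrite {1}eA !mulmxA; congr (_ *m _).
    rewrite -(mulmxA _ P) PPt mulmx1 -mulmxA; congr (_ *m _).
    rewrite mulmx_diag; congr diag_mx; apply/rowP => s.
    by rewrite !mxE exprSr.
  rewrite mxE; apply: eq_bigr => s _; rewrite mul_mx_diag !mxE //.
Qed.

(** The Jacobi matrix of the Laguerre polynomials, which are orthonormal for the
    exponential distribution, the law of [|z|^2] for a standard complex Gaussian [z]. *)
Definition laguerre m : 'M[C]_m.+1 :=
  \matrix_(i, j) ((i == j)%:R * (i + i + 1)%:R - (i == j.+1 :> nat)%:R * i%:R
                  - (j == i.+1 :> nat)%:R * j%:R).

Lemma sum_eq_nat m (g : nat -> C) p :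
  \sum_(j < m) (j == p :> nat)%:R * g j = (p < m)%:R * g p.
Proof.
case: (ltnP p m) => h.
  rewrite (bigD1 (Ordinal h)) //= eqxx mul1r big1 ?addr0 // => j nj.
  by rewrite (_ : (j == p :> nat) = false) ?mul0r //; apply/negbTE.
rewrite mul0r big1 // => j _; rewrite ltn_eqF ?mul0r //.
exact: leq_trans (ltn_ord j) h.
Qed.

Lemma laguerre_mul m (g : nat -> C) (i : 'I_m.+1) :
  \sum_j laguerre m i j * g j =
    (i + i + 1)%:R * g i - i%:R * g i.-1 - (i.+1 < m.+1)%:R * i.+1%:R * g i.+1.
Proof.
under eq_bigr do rewrite mxE !mulrBl.
rewrite !sumrB; congr (_ - _ - _).
- rewrite (bigD1 i) //= eqxx mul1r big1 ?addr0 // => j.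
  by rewrite eq_sym => /negPf->; rewrite !mul0r.
- case: i => -[|i] hi /=; first by rewrite !mul0r big1 // => j _; rewrite mul0r.
  rewrite (eq_bigr (fun j : 'I_m.+1 => (j == i :> nat)%:R * (i.+1%:R * g j))).
    by rewrite (sum_eq_nat _ (fun j => i.+1%:R * g j)) (ltn_trans _ hi) ?mul1r.
  by move=> j _; rewrite eqSS eq_sym mulrA.
- rewrite (eq_bigr (fun j : 'I_m.+1 => (j == i.+1 :> nat)%:R * (j%:R * g j))).
    by rewrite (sum_eq_nat _ (fun j => j%:R * g j)) mulrA.
  by move=> j _; rewrite mulrA.
Qed.

(** The first column of the [k]-th power is the expansion of [t^k] in Laguerre polynomials,
  whose
    coefficients are [k! (-1)^j 'C(k, j)]; the truncation at [m] is not felt while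
    [k <= m]. *)
Lemma laguerre_moment m k : (k <= m)%N -> (laguerre m ^+ k) ord0 ord0 = k`!%:R.
Proof.
pose v k j : C := k`!%:R * (-1) ^+ j * 'C(k, j)%:R.
suff H : (k <= m)%N -> forall i, (laguerre m ^+ k) i ord0 = v k i.
  by move=> /H->; rewrite /v expr0 bin0 !mulr1.
elim: k => [_ i|k IH km i].
  rewrite expr0 mxE /v fact0 mul1r bin0n; case: (i =P ord0) => [->|ne]; rewrite ?mulr1 //.
  rewrite (_ : (i == 0%N :> nat) = false) ?mulr0 //; apply/negbTE/eqP => e; apply: ne;
    exact/val_inj.
rewrite exprS mxE.
under eq_bigr do rewrite IH 1?ltnW //.
rewrite (laguerre_mul (v k)).
have -> : (i.+1 < m.+1)%:R * i.+1%:R * v k i.+1 = i.+1%:R * v k i.+1.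
  case: ltnP => h; first by rewrite mul1r.
  by rewrite /v bin_small ?mulr0 //; lia.
rewrite /v factS exprS.
case: (nat_of_ord i) => [|p] /=.
  by rewrite !bin0 bin1 !expr0 !natrM; ring.
rewrite exprS natrM.
have e1 : (p.+2 * 'C(k, p.+2))%:R = ((k - p.+1) * 'C(k, p.+1))%:R :> C.
  by rewrite mul_bin_left.
have e2 : (p.+1 * 'C(k, p.+1) + p * 'C(k,p))%:R = (k * 'C(k, p))%:R :> C.
  by rewrite mul_bin_left; case: (leqP p k) => h; [congr (_%:R);
    nia|rewrite bin_small // !muln0].
rewrite binS !natrD.
have e3 : ((k - p.+1) * 'C(k, p.+1) + p.+1 * 'C(k, p.+1))%:R = (k * 'C(k, p.+1))%:R :> C.
  by case: (leqP p.+1 k) => h; [congr (_%:R); nia|rewrite bin_small // !muln0].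
rewrite !natrM in e1; rewrite natrD !natrM in e2; rewrite natrD !natrM in e3.
move: e1 e2 e3; move: ('C(k, p.+2)%:R : C) ('C(k, p.+1)%:R : C) ('C(k, p)%:R : C) ((k -
  p.+1)%:R : C) ((-1)^+p : C) (k`!%:R : C) => x y z q s f.
move=> /eqP; rewrite -subr_eq0 => /eqP e1.
move=> /eqP; rewrite -subr_eq0 => /eqP e2.
move=> /eqP; rewrite -subr_eq0 => /eqP e3.
apply/eqP; rewrite -subr_eq0.
rewrite [X in X == 0](_ : _ =
  f * s * (- (p.+2%:R * x - q * y) - (q * y + p.+1%:R * y - k%:R * y)
   - (p.+1%:R * y + p%:R * z - k%:R * z))); last first.
  by rewrite -!natr1; ring.
by rewrite e1 e2 e3 !subr0 oppr0 mulr0.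
Qed.

Lemma laguerre_herm m : laguerre m \is hermsymmx.
Proof.
apply: realsym_hermsym.
  apply/is_hermitianmxP; rewrite expr0 scale1r map_mx_id //; apply/matrixP => i j.
  rewrite !mxE; case: (i =P j) => [->|ne]; first by rewrite eqxx.
  by rewrite (_ : (j == i) = false) ?mul0r ?sub0r 1?addrC //; apply/negbTE/eqP => /esym.
apply/mxOverP => i j; rewrite !mxE.
by rewrite !(rpredB, rpredM, realn).
Qed.

(** The form is a sum of the squares [i |y_i - y_(i-1)|^2], with [y] extended by zero.
    Hence the eigenvalues, which will be values of [|z|^2], are nonnegative. *)
Lemma laguerre_psd m (x : 'I_m.+1 -> C) :
  0 <= \sum_i \sum_j x i * laguerre m i j * (x j)^*.
Proof.
pose y k : C := if (k < m.+1)%N then x (inord k) else 0.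
have yE (i : 'I_m.+1) : x i = y i by rewrite /y ltn_ord inord_val.
pose a i : C := i%:R * (y i * (y i)^* - y i * (y i.-1)^*).
pose b i : C := i.+1%:R * (y i * (y i)^* - y i * (y i.+1)^*).
have -> : \sum_i \sum_j x i * laguerre m i j * (x j)^* = \sum_(i < m.+1) (a i + b i).
  apply: eq_bigr => i _.
  under eq_bigr => j _ do rewrite -mulrA (yE i) (yE j).
  rewrite -mulr_sumr (laguerre_mul (fun k => (y k)^*)).
  have -> : (i.+1 < m.+1)%:R * i.+1%:R * (y i.+1)^* = i.+1%:R * (y i.+1)^*.
    by rewrite /y; case: ltnP; rewrite ?mul1r // conjC0 !mulr0.
  by rewrite /a /b -!natr1 !natrD; ring.
have -> : \sum_(i < m.+1) (a i + b i) = \sum_(i < m.+1) (a i.+1 + b i).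
  (* Shift the first sum: its term at 0 vanishes, and so does the one at m + 1. *)
  rewrite !big_split /=; congr (_ + _).
  rewrite big_ord_recl [in RHS]big_ord_recr /= {1}/a mul0r add0r.
  have ym : y m.+1 = 0 by rewrite /y ltnn.
  by rewrite [a m.+1]/a ym !mul0r subrr mulr0 addr0.
apply: sumr_ge0 => i _.
have -> : a i.+1 + b i = i.+1%:R * ((y i.+1 - y i) * (y i.+1 - y i)^*).
  by rewrite /a /b rmorphB /=; ring.
by rewrite mulr_ge0 ?ler0n // mul_conjC_ge0.
Qed.

(** A finitely supported positive measure on the complex line whose moments agree with
    those of a standard complex Gaussian up to degree [m] in the variable and in its
      conjugate. *)
Definition moment_rule (m : nat) (J : finType) (wt nd : J -> C) : Prop :=
  (forall j, 0 <= wt j) /\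
  forall a b, (a <= m)%N -> (b <= m)%N ->
    \sum_j wt j * (nd j ^+ a * (nd j ^+ b)^*) = (a == b)%:R * a`!%:R.

(** The radii squared are the eigenvalues of [laguerre m], with the squared first
    components of the eigenvectors as weights; the phases are equidistributed on
    the [(m+1)]-st roots of unity, which kills the moments with [a <> b]. *)
Lemma moment_rule_exists m :
  exists (J : finType) (wt nd : J -> C), moment_rule m wt nd.
Proof.
have [P [D [_ Dr DE _ Dk]]] := hermitian_spectrum (laguerre_herm m).
have D0 s : 0 <= D s by rewrite DE; apply: laguerre_psd.
have [z zK] := prim_root_exists (ltn0Sn m).
exists ('I_m.+1 * 'I_m.+1)%type.
exists (fun j : 'I_m.+1 * 'I_m.+1 => (P j.1 ord0)^* * P j.1 ord0 / m.+1%:R).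
exists (fun j : 'I_m.+1 * 'I_m.+1 => sqrtC (D j.1) * z ^+ j.2); split=> [j|a b am bm].
  by rewrite divr_ge0 ?ler0n // mulrC mul_conjC_ge0.
rewrite -(pair_bigA _ (fun s t : 'I_m.+1 => (P s ord0)^* * P s ord0 / m.+1%:R *
  ((sqrtC (D s) * z ^+ t) ^+ a * ((sqrtC (D s) * z ^+ t) ^+ b)^*))) /=.
have sr s : (sqrtC (D s))^* = sqrtC (D s) by rewrite geC0_conj // sqrtC_ge0.
transitivity (\sum_s (P s ord0)^* * sqrtC (D s) ^+ (a + b) * P s ord0 * (a == b)%:R).
  apply: eq_bigr => s _.
  transitivity ((P s ord0)^* * sqrtC (D s) ^+ (a + b) * P s ord0 / m.+1%:R * \sum_(t <
    m.+1) (z ^+ t) ^+ a * ((z ^+ t) ^+ b)^*).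
    rewrite mulr_sumr; apply: eq_bigr => t _.
    by rewrite !exprMn rmorphM /= [X in X * _^*]rmorphXn /= sr exprD; ring.
  rewrite (sum_prim_root zK) // mulrA divfK // pnatr_eq0 //.
case: eqP => [<-|_]; last by rewrite mul0r big1 // => s _; rewrite mulr0.
rewrite mul1r -(laguerre_moment am) Dk; apply: eq_bigr => s _.
by rewrite mulr1 addnn -mul2n exprM sqrtCK.
Qed.

End Quadrature.

(** * Polarized forms and Gaussian expectations *)

Definition expect (C : numClosedFieldType) (J : finType) (wt nd : J -> C) (n : nat)
    (h : ('I_n -> C) -> C) : C :=
  \sum_(j : {ffun 'I_n -> J}) (\prod_l wt (j l)) * h (fun l => nd (j l)).

(** The factor by which the weight [|z|^(2q)] scales the Gaussian moments of degree [k]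
    of a vector of [n] variables. *)
Definition rise (n k q : nat) : nat := (\prod_(s < q) (n + k + s))%N.

Definition sqn (C : numClosedFieldType) (n : nat) (z : 'I_n -> C) : C :=
  \sum_l z l * (z l)^*.

(** The polarization of the form of [A] with [x] in the slots of [S] and [y] in the others. *)
Definition polar (R : comNzRingType) (n N : nat) (A : idx n N -> R) (S : {set 'I_N})
    (x y : 'I_n -> R) : R :=
  \sum_w A w * \prod_k (if k \in S then x (w k) else y (w k)).

Section Polar.
Variables (R : comNzRingType) (n N : nat) (A : idx n N -> R).

Lemma mon_add (x y : 'I_n -> R) (w : idx n N) :
  mon (fun l => x l + y l) w =
  \sum_(S : {set 'I_N}) \prod_k (if k \in S then x (w k) else y (w k)).
Proof. by rewrite /mon bigA_distr. Qed.

Lemma polar_sum (x y : 'I_n -> R) :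
  \sum_w A w * mon (fun l => x l + y l) w = \sum_S polar A S x y.
Proof.
rewrite exchange_big; apply: eq_bigr => w _; by rewrite mon_add mulr_sumr.
Qed.

Lemma card_eq_perm (S S' : {set 'I_N}) : #|S| = #|S'| ->
  exists s : 'S_N, forall k, (k \in S') = (s k \in S).
Proof.
move=> e; pose wd (S : {set 'I_N}) : idx 2 N :=
  [ffun k => if k \in S then ord0 else ord_max].
have c0 (X : {set 'I_N}) : cnt (wd X) ord0 = #|X|.
  rewrite ffunE -sum1_card [RHS]big_mkcond; apply: eq_bigr => k _.
  by rewrite ffunE; case: (k \in X).
have c1 (X : {set 'I_N}) : cnt (wd X) ord_max = #|~: X|.
  rewrite ffunE -sum1_card [RHS]big_mkcond; apply: eq_bigr => k _.
  by rewrite ffunE inE; case: (k \in X).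
have [|s es] := @cnt_eq_permute 2 N (wd S) (wd S').
  apply/ffunP => l; have [->|->] : l = ord0 \/ l = ord_max.
  - by case: l => -[|[|//]] h; [left|right]; apply/val_inj.
  - by rewrite !c0.
  - by rewrite !c1; apply/eqP; rewrite -(eqn_add2l #|S|) {2}e !cardsC.
exists s => k; have /ffunP/(_ k) := es; rewrite !ffunE.
by case: (k \in S'); case: (s k \in S).
Qed.

(** A permutation of the slots carries [S] to [S']. *)
Lemma polar_card (S S' : {set 'I_N}) x y : count_sym A -> #|S| = #|S'| ->
  polar A S x y = polar A S' x y.
Proof.
move=> As /card_eq_perm[s es]; rewrite /polar.
have inj : injective (permute_idx s : idx n N -> idx n N).
  move=> u w /ffunP e; apply/ffunP => k; have := e ((s^-1)%g k).
  by rewrite !ffunE permKV.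
rewrite [RHS](reindex_inj inj) /=; apply: eq_bigr => w _.
rewrite (As (permute_idx s w) w) ?cnt_permute //; congr (_ * _).
rewrite (reindex_inj (@perm_inj _ s)) /=; apply: eq_bigr => k _.
by rewrite es ffunE.
Qed.

Lemma polarT x y : polar A setT x y = \sum_w A w * mon x w.
Proof.
by apply: eq_bigr => w _; congr (_ * _); apply: eq_bigr => k _; rewrite inE.
Qed.

End Polar.

Lemma polar_left (R : comNzRingType) (n a b : nat) (A : idx n (a + b) -> R) x y :
  polar A [set lshift b k | k : 'I_a] x y =
  \sum_i \sum_j A (join_word erefl i j) * (mon x i * mon y j).
Proof.
rewrite /polar (sum_join erefl); apply: eq_bigr => i _; apply: eq_bigr => j _.
congr (_ * _).
rewrite (prod_join erefl (fun k l => if k \in _ then x l else y l)).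
congr (_ * _); apply: eq_bigr => k _; rewrite cast_ord_id.
  by rewrite imset_f.
case: imsetP => // -[k' _ /(congr1 val) /= e]; move: (ltn_ord k'); rewrite -e; lia.
Qed.

Section Expect.
Variables (C : numClosedFieldType) (J : finType) (wt nd : J -> C) (m n : nat).
Hypothesis rule : moment_rule m wt nd.
Notation E := (expect wt nd (n := n)).
Implicit Types (h g : ('I_n -> C) -> C) (z : 'I_n -> C) (a b : expo n).

Lemma expect_ext h g : h =1 g -> E h = E g.
Proof. by move=> e; apply: eq_bigr => j _; rewrite e. Qed.

Lemma expect_sum (I : finType) (F : I -> ('I_n -> C) -> C) :
  E (fun z => \sum_i F i z) = \sum_i E (F i).
Proof. by rewrite exchange_big; apply: eq_bigr => j _; rewrite mulr_sumr. Qed.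

Lemma expectZ c h : E (fun z => c * h z) = c * E h.
Proof. by rewrite mulr_sumr; apply: eq_bigr => j _; rewrite mulrCA. Qed.

Lemma expectD h g : E (fun z => h z + g z) = E h + E g.
Proof. by rewrite -big_split; apply: eq_bigr => j _; rewrite mulrDr. Qed.

Lemma expectN h : E (fun z => - h z) = - E h.
Proof. by rewrite -sumrN; apply: eq_bigr => j _; rewrite mulrN. Qed.

Lemma expect_wt_ge0 (j : {ffun 'I_n -> J}) : 0 <= \prod_l wt (j l).
Proof. by apply: prodr_ge0 => l _; apply: (rule.1). Qed.

Lemma expect_ge0 h : (forall z, 0 <= h z) -> 0 <= E h.
Proof. by move=> h0; apply: sumr_ge0 => j _; rewrite mulr_ge0 ?expect_wt_ge0. Qed.

Lemma expect_conj h : E (fun z => (h z)^*) = (E h)^*.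
Proof.
rewrite rmorph_sum; apply: eq_bigr => j _; rewrite rmorphM /=; congr (_ * _).
by rewrite geC0_conj // expect_wt_ge0.
Qed.

Lemma expect_monx a b : (deg a <= m)%N -> (deg b <= m)%N ->
  E (fun z => monx z a * (monx z b)^*) = (wick_expo a b)%:R.
Proof.
move=> am bm; rewrite /expect /monx.
under eq_bigr => j _ do rewrite rmorph_prod /= -big_split -big_split /=.
rewrite -(bigA_distr_bigA (fun l j => wt j * (nd j ^+ a l * (nd j ^+ b l)^*))) /=.
under eq_bigr => l _ do rewrite (rule.2 _ _ (leq_trans (leq_deg a l) am) (leq_trans
  (leq_deg b l) bm)).
rewrite /wick_expo; case: eqP => [->|ne].
  by rewrite /fact_expo natr_prod; apply: eq_bigr => l _; rewrite eqxx mul1r.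
have [l /negPf hl] : exists l, a l != b l.
  apply/existsP; rewrite -negb_forall; apply: contra_notN ne => /forallP e.
  by apply/ffunP => l; apply/eqP.
by rewrite (bigD1 l) //= hl !mul0r.
Qed.

Lemma monx_inc z l a : monx z (inc l a) = z l * monx z a.
Proof.
rewrite /monx (bigD1 l) //= [in RHS](bigD1 l) //= ffunE eqxx exprS mulrA.
by congr (_ * _); apply: eq_bigr => k /negPf nk; rewrite ffunE nk.
Qed.

Lemma wick_expo_inc_both l a b : wick_expo (inc l a) (inc l b) = ((a l).+1 * wick_expo a b)%N.
Proof.
rewrite wick_expo_inc dec_inc /wick_expo; case: eqP => [->|]; rewrite ?muln0 //.
by rewrite ffunE eqxx.
Qed.

(** Multiplying out one factor [|z|^2] raises the exponent of some letter [l] on both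
    sides, at the cost of [a l + 1]; these factors add up to [n + deg a]. *)
Lemma expect_sqn q a b : (deg a + q <= m)%N -> (deg b + q <= m)%N ->
  E (fun z => sqn z ^+ q * (monx z a * (monx z b)^*)) =
  (rise n (deg a) q * wick_expo a b)%:R.
Proof.
elim: q a b => [|q IH] a b am bm.
  rewrite /rise big_ord0 mul1n -expect_monx; [|lia|lia].
  by apply: expect_ext => z; rewrite expr0 mul1r.
transitivity (\sum_l E (fun z => sqn z ^+ q * (monx z (inc l a) * (monx z (inc l b))^*))).
  rewrite -expect_sum; apply: expect_ext => z.
  rewrite exprSr {2}/sqn -mulrA mulr_suml mulr_sumr; apply: eq_bigr => l _.
  by rewrite !monx_inc rmorphM /=; ring.
under eq_bigr => l _.
  rewrite IH ?deg_inc; [|lia|lia]; rewrite wick_expo_inc_both mulnCA mulnC; over.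
rewrite -natr_sum; congr (_%:R).
rewrite -big_distrr /= mulnC mulnA; congr (_ * _)%N.
have -> : (\sum_(i < n) (a i).+1 = n + deg a)%N.
  under eq_bigr do rewrite -addn1.
  by rewrite big_split /= sum1_card card_ord addnC.
rewrite /rise big_ord_recl addn0; congr (_ * _)%N.
by apply: eq_bigr => s _; rewrite lift0 !addnS.
Qed.

Lemma expect_word q k (i j : idx n k) : (k + q <= m)%N ->
  E (fun z => sqn z ^+ q * (mon z i * (mon z j)^*)) = (rise n k q)%:R * (wick i j)%:R.
Proof.
move=> kq; rewrite -natrM; have := @expect_sqn q (cnt i) (cnt j); rewrite !deg_cnt => <- //.
by apply: expect_ext => z; rewrite !monE.
Qed.

Lemma expect_deg_neq a b : (deg a <= m)%N -> (deg b <= m)%N -> deg a <> deg b ->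
  E (fun z => monx z a * (monx z b)^*) = 0.
Proof.
move=> am bm ab; rewrite expect_monx // /wick_expo; case: eqP => // e.
by case: ab; rewrite e.
Qed.

Lemma monx_addx z a b : monx z (addx a b) = monx z a * monx z b.
Proof. by rewrite /monx -big_split; apply: eq_bigr => l _; rewrite ffunE exprD. Qed.

(** Invariance of the Gaussian under a common phase: unbalanced degrees have mean zero. *)
Lemma expect_polar0 N (A : idx n N -> C) (S : {set 'I_N}) a b :
  (N + deg a <= m)%N -> (N + deg b <= m)%N -> (#|S| + deg a)%N <> (N - #|S| + deg b)%N ->
  E (fun z => polar A S z (fun l => (z l)^*) * (monx z a * (monx z b)^*)) = 0.
Proof.
move=> am bm ne.
pose c (S : {set 'I_N}) (w : idx n N) : expo n := [ffun l => \sum_(k in S) (w k == l)]%N.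
have degc (X : {set 'I_N}) w : deg (c X w) = #|X|.
  rewrite /deg; under eq_bigr do rewrite ffunE.
  rewrite exchange_big /= -sum1_card; apply: eq_bigr => k _.
  by rewrite (bigD1 (w k)) //= eqxx big1 ?addn0 // => l; rewrite eq_sym => /negPf->.
have cE (X : {set 'I_N}) (w : idx n N) z : \prod_(k in X) z (w k) = monx z (c X w).
  rewrite /monx; under [RHS]eq_bigr => l _ do rewrite ffunE -prodrXr.
  rewrite exchange_big /=; apply: eq_bigr => k _.
  rewrite (bigD1 (w k)) //= eqxx big1 ?mulr1 // => l.
  by rewrite eq_sym => /negPf->.
transitivity (\sum_w A w * E (fun z =>
  monx z (addx (c S w) a) * (monx z (addx (c (~: S) w) b))^*)).
  under [RHS]eq_bigr do rewrite -expectZ.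
  rewrite -expect_sum; apply: expect_ext => z; rewrite mulr_suml; apply: eq_bigr => w _.
  rewrite -mulrA; congr (_ * _).
  rewrite (bigID (fun k => k \in S)) /=.
  rewrite (eq_bigr (fun k => z (w k))); last by move=> k ->.
  rewrite [X in _ * X * _ = _](eq_bigr (fun k => (z (w k))^*)); last by move=> k /negPf->.
  rewrite cE -rmorph_prod /= (eq_bigl (fun k => k \in ~: S)); last by move=> k; rewrite inE.
  by rewrite cE !monx_addx rmorphM /=; ring.
apply: big1 => w _; have cS : (#|S| <= N)%N by rewrite -[leqRHS]card_ord max_card.
have cC : #|~: S| = (N - #|S|)%N by rewrite cardsCs setCK card_ord.
rewrite expect_deg_neq ?mulr0 // !deg_addx !degc ?cC //; move: (#|S|) cS => p; lia.
Qed.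

End Expect.

(** * Reduced tensors and mixtures of product states *)

(** The partial trace of [v v^T] over the last [b] legs. *)
Definition reduced (R : comNzRingType) (n d b r : nat) (e : (d + b)%N = r)
    (v : idx n r -> R) (i j : idx n d) : R :=
  \sum_k v (join_word e i k) * v (join_word e j k).

Section Consequences.
Variables (C : numClosedFieldType) (n : nat).

Lemma addcj_real (z : C) : z + z^* \is Num.real.
Proof. by apply/CrealP; rewrite rmorphD /= conjCK addrC. Qed.

(** Pairing the form at the real point [z + conj z] with the conjugate of [z^(w0)] keeps
    only the part that is holomorphic of full degree, whose moment is [N!] times
    the coefficient at [w0]. *)
Lemma complex_form_eq0 N (A : idx n N -> C) : count_sym A ->
  (forall x, (forall l, x l \is Num.real) -> \sum_w A w * mon x w = 0) ->
  forall w, A w = 0.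
Proof.
move=> As A0 w0.
have [J [wt [nd rule]]] := moment_rule_exists C (N + N).
have H : expect wt nd (fun z => (\sum_w A w * mon (fun l => z l + (z l)^*) w) *
   (monx z (expo0 n) * (monx z (cnt w0))^*)) = 0.
  rewrite /expect big1 // => j _; rewrite A0 ?mul0r ?mulr0 // => l.
  exact: addcj_real.
have d0 : deg (expo0 n) = 0%N by rewrite /deg big1 // => l _; rewrite ffunE.
have E0 : expect wt nd (fun z => polar A setT z (fun l => (z l)^*) *
   (monx z (expo0 n) * (monx z (cnt w0))^*)) = 0.
  rewrite -[RHS]H.
  under [RHS]expect_ext do rewrite polar_sum mulr_suml.
  rewrite expect_sum (bigD1 setT) //= big1 ?addr0 // => S nS.
  rewrite (expect_polar0 rule) ?deg_cnt ?d0 //; first by lia.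
  have : (#|S| <= N)%N by rewrite -[leqRHS]card_ord max_card.
  rewrite leq_eqVlt => /orP[/eqP e|]; last by move: (#|S|) => p; lia.
  case/eqP: nS; apply/eqP; rewrite eqEcard subsetT cardsT card_ord.
  by rewrite e leqnn.
have {}E0 : \sum_w (wick w w0)%:R * A w = 0.
  rewrite -[RHS]E0.
  under [RHS]expect_ext do rewrite polarT mulr_suml.
  rewrite expect_sum; apply: eq_bigr => w _.
  under [RHS]expect_ext do rewrite -mulrA.
  rewrite expectZ mulrC; congr (_ * _).
  rewrite /wick -(expect_monx rule) ?deg_cnt ?leq_addr //; apply: expect_ext => z.
  rewrite monE; congr (_ * _); rewrite [X in _ = X * _](_ : _ = 1) ?mul1r //.
  by rewrite /monx big1 // => l _; rewrite ffunE.
move: E0; rewrite wick_sym // => /eqP; rewrite mulf_eq0 pnatr_eq0 -leqn0 leqNgt fact_gt0 /=.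
by move/eqP.
Qed.

Variables (d r : nat) (v : idx n r -> C) (J : finType) (wt nd : J -> C) (m : nat).
Hypotheses (rule : moment_rule m wt nd) (v_real : forall K, (v K)^* = v K)
  (v_sym : count_sym v).
Notation E := (expect wt nd (n := n)).

Definition antihol (z : 'I_n -> C) : C := \sum_K v K * (mon z K)^*.

Lemma antihol_norm z : antihol z * (antihol z)^* =
  \sum_K \sum_K' v K * v K' * (monx z (cnt K') * (monx z (cnt K))^*).
Proof.
rewrite /antihol rmorph_sum mulr_suml; apply: eq_bigr => K _.
rewrite mulr_sumr; apply: eq_bigr => K' _.
by rewrite rmorphM /= conjCK v_real !monE; ring.
Qed.

(** The weight [|V|^2] is invariant under a common phase, so in the mean of
    [|V|^2 f(z + conj z)], which is nonnegative, only the polarizations with [d]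
    slots of each kind survive, and they all coincide. *)
Lemma expect_form_ge0 (A : idx n (d + d) -> C) : count_sym A -> (d + d + r <= m)%N ->
  (forall x, (forall l, x l \is Num.real) -> 0 <= \sum_w A w * mon x w) ->
  0 <= E (fun z => (\sum_i \sum_j A (join_word erefl i j) * (mon z i * (mon z j)^*)) *
            (antihol z * (antihol z)^*)).
Proof.
move=> As dm Apos; set e := E _.
suff : 0 <= 'C(d + d, d)%:R * e.
  by rewrite pmulr_rge0 // ltr0n bin_gt0 leq_addr.
have <- : E (fun z => (\sum_w A w * mon (fun l => z l + (z l)^*) w) *
  (antihol z * (antihol z)^*)) = 'C(d + d, d)%:R * e; last first.
  apply: sumr_ge0 => j _; rewrite mulr_ge0 ?(expect_wt_ge0 rule) // mulr_ge0 ?mul_conjC_ge0 //.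
  by apply: Apos => l; apply: addcj_real.
under expect_ext do rewrite polar_sum mulr_suml.
rewrite expect_sum (bigID (fun S : {set 'I_(d + d)} => #|S| == d)) /= [X in _ + X]big1 ?addr0.
  have cS0 : #|[set lshift d k | k : 'I_d]| = d.
    by rewrite card_imset ?card_ord //; apply: lshift_inj.
  rewrite (eq_bigr (fun _ => e)).
    rewrite sumr_const mulr_natl; congr (_ *+ _).
    by rewrite -[X in 'C(X, _)](card_ord (d + d)) -card_draws; apply: eq_card => S;
      rewrite !inE.
  move=> S /eqP cS; apply: expect_ext => z; congr (_ * _).
  rewrite (@polar_card _ _ _ _ _ [set lshift d k | k : 'I_d]) ?cS ?cS0 // polar_left.
  apply: eq_bigr => i _; apply: eq_bigr => j _; congr (_ * (_ * _)).
  by rewrite /mon rmorph_prod.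
move=> S cS; transitivity (\sum_K \sum_K' v K * v K' * E (fun z => polar A S z (fun l =>
  (z l)^*) *
   (monx z (cnt K') * (monx z (cnt K))^*))).
  under [RHS]eq_bigr do under eq_bigr do rewrite -expectZ.
  under [RHS]eq_bigr do rewrite -expect_sum.
  rewrite -expect_sum; apply: expect_ext => z; rewrite antihol_norm mulr_sumr.
  apply: eq_bigr => K _; rewrite mulr_sumr; apply: eq_bigr => K' _; ring.
rewrite big1 // => K _; rewrite big1 // => K' _.
rewrite (expect_polar0 rule) ?mulr0 ?deg_cnt //.
have : (#|S| <= d + d)%N by rewrite -[leqRHS]card_ord max_card.
by move: (#|S|) cS => p; lia.
Qed.

Variables (b : nat) (e : (d + b)%N = r).

Definition slice (z : 'I_n -> C) (i : idx n d) : C :=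
  \sum_k v (join_word e i k) * (mon z k)^*.

Notation rho := (reduced e v).

(** This is [w - P w], with [w] the [slice], multiplied by [|z|^(2d)] to clear the
    denominator of the projection onto the [d]-th power of [z]. *)
Definition residue (z : 'I_n -> C) (i : idx n d) : C :=
  sqn z ^+ d * slice z i - mon z i * antihol z.

Definition slice_const : nat := (rise n b (d + d) * b`!)%N.
Definition cross_const : nat := (rise n r d * r`!)%N.

Lemma sqn_conj (z : 'I_n -> C) : (sqn z)^* = sqn z.
Proof.
rewrite rmorph_sum; apply: eq_bigr => l _.
by rewrite rmorphM /= conjCK mulrC.
Qed.

Lemma join_count_sym j : count_sym (fun k => v (join_word e j k)).
Proof. by move=> k k' ek; apply: v_sym; rewrite !cnt_join ek. Qed.

Lemma reducedC i j : rho i j = rho j i.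
Proof. by apply: eq_bigr => k _; rewrite mulrC. Qed.

Lemma reduced_conj i j : (rho i j)^* = rho i j.
Proof. by rewrite rmorph_sum; apply: eq_bigr => k _; rewrite rmorphM /= !v_real. Qed.

Lemma expect_slice i j : (b + (d + d) <= m)%N ->
  E (fun z => sqn z ^+ (d + d) * (slice z i * (slice z j)^*)) = slice_const%:R * rho i j.
Proof.
move=> bm.
transitivity (\sum_k \sum_l v (join_word e i k) * v (join_word e j l) *
   E (fun z => sqn z ^+ (d + d) * (mon z l * (mon z k)^*))).
  under [RHS]eq_bigr do under eq_bigr do rewrite -expectZ.
  under [RHS]eq_bigr do rewrite -expect_sum.
  rewrite -expect_sum; apply: expect_ext => z; rewrite /slice rmorph_sum mulr_suml mulr_sumr.
  apply: eq_bigr => k _; rewrite !mulr_sumr; apply: eq_bigr => l _.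
  by rewrite rmorphM /= conjCK v_real; ring.
under eq_bigr do under eq_bigr do rewrite (expect_word rule) //.
rewrite /reduced mulr_sumr; apply: eq_bigr => k _.
transitivity (v (join_word e i k) * (rise n b (d + d))%:R * (\sum_l (wick l k)%:R * v
  (join_word e j l))).
  by rewrite mulr_sumr; apply: eq_bigr => l _; ring.
by rewrite (wick_sym k (join_count_sym j)) /slice_const natrM; ring.
Qed.

(** The key identity: the [d]-th power of [z] times the [(r-d)]-th power contracted in
    the last slots is an [r]-th power of [z], and averaging it against [V] is the
    projection of [v] onto symmetric tensors, which returns [v]. *)
Lemma expect_cross i j : (r + d <= m)%N ->
  E (fun z => sqn z ^+ d * (mon z i * antihol z * (slice z j)^*)) = cross_const%:R * rho i j.
Proof.
move=> rm.
transitivity (\sum_l \sum_K v (join_word e j l) * v K *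
   E (fun z => sqn z ^+ d * (mon z (join_word e i l) * (mon z K)^*))).
  under [RHS]eq_bigr do under eq_bigr do rewrite -expectZ.
  under [RHS]eq_bigr do rewrite -expect_sum.
  rewrite -expect_sum; apply: expect_ext => z.
  rewrite /slice /antihol rmorph_sum !mulr_sumr.
  apply: eq_bigr => l _; rewrite mulr_suml mulr_sumr; apply: eq_bigr => K _.
  by rewrite rmorphM /= conjCK v_real mon_join; ring.
under eq_bigr do under eq_bigr do rewrite (expect_word rule) // wickC.
rewrite /reduced mulr_sumr; apply: eq_bigr => l _.
transitivity (v (join_word e j l) * (rise n r d)%:R * (\sum_K (wick K (join_word e i l))%:R
  * v K)).
  by rewrite mulr_sumr; apply: eq_bigr => K _; ring.
by rewrite wick_sym // /cross_const natrM; ring.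
Qed.

Lemma expect_antihol : (r + d <= m)%N ->
  E (fun z => sqn z ^+ d * (antihol z * (antihol z)^*)) = cross_const%:R * \sum_K v K ^+ 2.
Proof.
move=> rm.
transitivity (\sum_K \sum_K' v K * v K' * E (fun z => sqn z ^+ d * (mon z K' * (mon z K)^*))).
  under [RHS]eq_bigr do under eq_bigr do rewrite -expectZ.
  under [RHS]eq_bigr do rewrite -expect_sum.
  rewrite -expect_sum; apply: expect_ext => z.
  rewrite antihol_norm mulr_sumr; apply: eq_bigr => K _; rewrite mulr_sumr.
  by apply: eq_bigr => K' _; rewrite !monE; ring.
under eq_bigr do under eq_bigr do rewrite (expect_word rule) //.
rewrite mulr_sumr; apply: eq_bigr => K _.
transitivity (v K * (rise n r d)%:R * (\sum_K' (wick K' K)%:R * v K')).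
  by rewrite mulr_sumr; apply: eq_bigr => K' _; ring.
by rewrite wick_sym // /cross_const natrM; ring.
Qed.

(** Both mixed terms of the product are multiples of [rho], by [expect_cross]; only the
    mixture of product states remains as a separate term. *)
Lemma expect_residue i j : (r + d <= m)%N ->
  E (fun z => residue z i * (residue z j)^*) =
  (slice_const%:R - 2%:R * cross_const%:R) * rho i j +
  E (fun z => mon z i * (mon z j)^* * (antihol z * (antihol z)^*)).
Proof.
move=> rm; have bm : (b + (d + d) <= m)%N by rewrite -e in rm; lia.
transitivity (E (fun z => sqn z ^+ (d + d) * (slice z i * (slice z j)^*)) +
  (- E (fun z => sqn z ^+ d * (mon z i * antihol z * (slice z j)^*)) +
  (- (E (fun z => sqn z ^+ d * (mon z j * antihol z * (slice z i)^*)))^* +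
   E (fun z => mon z i * (mon z j)^* * (antihol z * (antihol z)^*))))).
  rewrite -(expect_conj rule) -!expectN -!expectD; apply: expect_ext => z.
  rewrite /residue rmorphB !rmorphM /= !rmorphXn /= sqn_conj conjCK exprD; ring.
rewrite expect_slice // !expect_cross //.
have -> : (cross_const%:R * rho j i)^* = cross_const%:R * rho i j.
  by rewrite rmorphM /= conjC_nat reduced_conj reducedC.
ring.
Qed.

Lemma sum_mon_norm (z : 'I_n -> C) : \sum_(i : idx n d) mon z i * (mon z i)^* = sqn z ^+ d.
Proof.
rewrite /sqn -[d in RHS]card_ord -prodr_const bigA_distr_bigA /=.
by apply: eq_bigr => i _; rewrite /mon rmorph_prod -big_split.
Qed.

Lemma sum_reduced : \sum_i rho i i = \sum_K v K ^+ 2.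
Proof.
rewrite (sum_join e (fun K => v K ^+ 2)); apply: eq_bigr => i _.
by apply: eq_bigr => k _; rewrite expr2.
Qed.

Lemma residue_count_sym z : count_sym (residue z).
Proof.
move=> i j eij; rewrite /residue !monE eij; congr (_ * _ - _).
by apply: eq_bigr => k _; congr (_ * _); apply: v_sym; rewrite !cnt_join eij.
Qed.

(** The residue is a symmetric tensor, so [A] is at most [K1] there; the product states
    contribute nonnegatively. The trace of the second moment of the residue is the
    difference of the two constants times the squared norm of [v]. *)
Lemma de_finetti_bound (A : idx n (d + d) -> C) (K1 : C) : count_sym A ->
  (forall x, (forall l, x l \is Num.real) -> 0 <= \sum_w A w * mon x w) ->
  (forall u : idx n d -> C, count_sym u ->
     \sum_i \sum_j A (join_word erefl i j) * (u i * (u j)^*) <= K1 * \sum_i u i * (u i)^*) ->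
  (r + d + d <= m)%N ->
  (slice_const%:R - 2%:R * cross_const%:R) * (\sum_i \sum_j A (join_word erefl i j) * rho i
    j) <=
   K1 * ((slice_const%:R - cross_const%:R) * \sum_K v K ^+ 2).
Proof.
move=> As Apos AK rm; have rm' : (r + d <= m)%N by lia.
have := expect_form_ge0 As _ Apos; rewrite addnC addnA => /(_ rm).
set P := E _ => P0.
have <- : E (fun z => \sum_i \sum_j A (join_word erefl i j) * (residue z i * (residue z
  j)^*)) - P =
  (slice_const%:R - 2%:R * cross_const%:R) * (\sum_i \sum_j A (join_word erefl i j) * rho i j).
  apply/eqP; rewrite subr_eq; apply/eqP.
  rewrite expect_sum [in RHS]mulr_sumr.
  rewrite {P0}/P.
  under [X in _ = _ + X]expect_ext do rewrite mulr_suml.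
  rewrite [X in _ = _ + X]expect_sum -big_split /=; apply: eq_bigr => i _.
  rewrite expect_sum mulr_sumr.
  under [X in _ = _ + X]expect_ext do rewrite mulr_suml.
  rewrite [X in _ = _ + X]expect_sum -big_split /=; apply: eq_bigr => j _.
  rewrite expectZ expect_residue // mulrDr; congr (_ + _); first by ring.
  by rewrite -expectZ; apply: expect_ext => z; ring.
have -> : K1 * ((slice_const%:R - cross_const%:R) * \sum_K v K ^+ 2) =
   E (fun z => K1 * \sum_i residue z i * (residue z i)^*).
  rewrite expectZ expect_sum; congr (_ * _).
  under [RHS]eq_bigr do rewrite expect_residue //.
  rewrite big_split /= -mulr_sumr sum_reduced -expect_sum.
  under [X in _ = _ + X]expect_ext do rewrite -mulr_suml sum_mon_norm.
  rewrite expect_antihol //; ring.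
apply: (@le_trans _ _ (E (fun z =>
  \sum_i \sum_j A (join_word erefl i j) * (residue z i * (residue z j)^*)))).
  by rewrite gerBl.
rewrite -subr_ge0 -expectN -expectD; apply: (expect_ge0 rule) => z.
by rewrite subr_ge0; apply: AK; apply: residue_count_sym.
Qed.

End Consequences.

(** * The approximation over the reals *)

Section Ratio.
Variable R : realFieldType.

(** The quotient of [cross_const] and [slice_const]; it is the quotient of the dimensions
    of the symmetric powers of order [b] and [d + b]. *)
Definition cratio (n d b : nat) : R :=
  (rise n (d + b) d * (d + b)`!)%:R / (rise n b (d + d) * b`!)%:R.

Lemma rise_gt0 n k q : (0 < n)%N -> (0 < rise n k q)%N.
Proof. by move=> n0; apply: prodn_gt0 => s; rewrite !addn_gt0 n0. Qed.

Lemma rise_split n k p q : rise n k (p + q) = (rise n k p * rise n (k + p) q)%N.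
Proof.
rewrite /rise big_split_ord /=; congr (_ * _)%N.
by apply: eq_bigr => s _; rewrite !addnA.
Qed.

Lemma rise1 k q : (rise 1 k q * k`! = (k + q)`!)%N.
Proof.
elim: q => [|q IH]; first by rewrite /rise big_ord0 addn0 mul1n.
by rewrite /rise big_ord_recr /= mulnAC -/(rise 1 k q) IH addnS factS mulnC add1n addSn.
Qed.

Lemma riseS n k q : (rise n.+1 k q * (n + k) = rise n k q * (n + k + q))%N.
Proof.
elim: q => [|q IH]; first by rewrite /rise !big_ord0 addn0.
by rewrite /rise !big_ord_recr /= mulnAC -!/(rise _ k q) IH !addSn addnS.
Qed.

Lemma cratioE n d b : (0 < n)%N ->
  cratio n d b = (d + b)`!%:R / (rise n b d * b`!)%:R.
Proof.
move=> n0; rewrite /cratio rise_split addnC (addnC b d) !natrM.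
have h1 : (rise n (d + b) d)%:R != 0 :> R by rewrite pnatr_eq0 -lt0n rise_gt0.
have h2 : (rise n b d)%:R != 0 :> R by rewrite pnatr_eq0 -lt0n rise_gt0.
have h3 : (b`!)%:R != 0 :> R by rewrite pnatr_eq0 -lt0n fact_gt0.
by field; rewrite h1 h2 h3.
Qed.

(** Passing from [n] to [n + 1] multiplies the ratio by [1 - d / (n + d + b)], so each
    step costs at most [d / (d + b + 1)]. *)
Lemma cratio_bounds n d b : (0 < n)%N ->
  [/\ 0 <= cratio n d b, cratio n d b <= 1 &
   1 - cratio n d b <= d%:R * (n%:R - 1) / ((d + b)%:R + 1)].
Proof.
case: n => // n _; elim: n => [|n [IH0 IH1 IH2]].
  rewrite cratioE // rise1 addnC divff ?pnatr_eq0 -?lt0n ?fact_gt0 // !subrr mulr0 mul0r.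
  by split.
set c := cratio _ _ _ in IH0 IH1 IH2.
have e : cratio n.+2 d b = c * (1 - d%:R / (n.+1 + d + b)%:R).
  rewrite /c !cratioE // !natrM.
  have hd : (n.+1 + d + b)%:R != 0 :> R by rewrite pnatr_eq0.
  have hb : (n.+1 + b)%:R != 0 :> R by rewrite pnatr_eq0.
  have h2 : (rise n.+1 b d)%:R != 0 :> R by rewrite pnatr_eq0 -lt0n rise_gt0.
  have h2' : (rise n.+2 b d)%:R != 0 :> R by rewrite pnatr_eq0 -lt0n rise_gt0.
  have h3 : (b`!)%:R != 0 :> R by rewrite pnatr_eq0 -lt0n fact_gt0.
  have -> : 1 - d%:R / (n.+1 + d + b)%:R = (n.+1 + b)%:R / (n.+1 + d + b)%:R :> R.
    by apply: (mulIf hd); rewrite mulrBl mul1r !divfK // addnAC natrD addrK.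
  have -> : (rise n.+2 b d)%:R = (rise n.+1 b d)%:R * (n.+1 + d + b)%:R / (n.+1 + b)%:R :> R.
    by apply: (mulIf hb); rewrite divfK // -!natrM riseS addnAC.
  move: hd hb h2 h3; move: ((n.+1 + d + b)%:R : R) ((n.+1 + b)%:R : R).
  move: ((rise n.+1 b d)%:R : R) (b`!%:R : R) ((d + b)`!%:R : R) => x y z s t hs ht hx hy.
  by field; rewrite hs ht hx hy.
have dpos : 0 <= d%:R / (n.+1 + d + b)%:R :> R by rewrite divr_ge0 ?ler0n.
have dle : d%:R / (n.+1 + d + b)%:R <= 1 :> R.
  by rewrite ler_pdivrMr ?ltr0n // mul1r ler_nat; lia.
have dle2 : d%:R / (n.+1 + d + b)%:R <= d%:R / ((d + b)%:R + 1) :> R.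
  rewrite ler_wpM2l ?ler0n // natr1 lef_pV2 ?posrE ?ltr0n // ler_nat; lia.
rewrite e; split.
- by rewrite mulr_ge0 // subr_ge0.
- apply: le_trans IH1; rewrite ler_piMr // gerBl //.
have -> : d%:R * (n.+2%:R - 1) / ((d + b)%:R + 1) =
   d%:R * (n.+1%:R - 1) / ((d + b)%:R + 1) + d%:R / ((d + b)%:R + 1) :> R.
  rewrite -mulrDl; congr (_ / _); rewrite -[n.+2%:R]natr1; ring.
have : c * (d%:R / (n.+1 + d + b)%:R) <= d%:R / ((d + b)%:R + 1).
  by apply: le_trans dle2; rewrite ler_piMl.
move: IH2; rewrite mulrBr mulr1; lra.
Qed.

End Ratio.

Section Real.
Variables (R : realType) (n d : nat).
Local Open Scope complex_scope.
Notation C := (R[i]).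
Notation toC := (real_complex R).

Lemma conj_toC (x : R) : (Num.conj (toC x)) = toC x.
Proof. by apply/CrealP; rewrite complex_real. Qed.

Lemma real_fun (x : 'I_n -> C) : (forall l, x l \is Num.real) ->
  exists y : 'I_n -> R, x =1 (fun l => toC (y l)).
Proof.
move=> xr; exists (fun l => complex.Re (x l)) => l; by rewrite RRe_real.
Qed.

Lemma mon_toC N (y : 'I_n -> R) (w : idx n N) : mon (fun l => toC (y l)) w = toC (mon y w).
Proof. by rewrite /mon rmorph_prod. Qed.

Lemma form_toC N (A : idx n N -> R) (x : 'I_n -> C) (y : 'I_n -> R) :
  x =1 (fun l => toC (y l)) ->
  \sum_w toC (A w) * mon x w = toC (\sum_w A w * mon y w).
Proof.
move=> xy; rewrite rmorph_sum; apply: eq_bigr => w _.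
rewrite rmorphM /= -mon_toC; congr (_ * _); apply: eq_bigr => k _; exact: xy.
Qed.

Lemma tensor_form_eq0 N (A : idx n N -> R) : count_sym A ->
  (forall x, \sum_w A w * mon x w = 0) -> forall w, A w = 0.
Proof.
move=> As A0 w; apply: (@complexI R).
apply: (@complex_form_eq0 C n N (fun w => toC (A w))).
  by move=> i j e; rewrite (As i j).
by move=> x /real_fun[y xy]; rewrite (form_toC _ xy) A0.
Qed.

(** The cross terms between real and imaginary parts are antisymmetric in [i] and [j]. *)
Lemma herm_real (A : idx n d -> idx n d -> R) (u : idx n d -> C) :
  (forall i j, A i j = A j i) ->
  \sum_i \sum_j toC (A i j) * (u i * Num.conj (u j)) =
  toC (\sum_i \sum_j A i j * (complex.Re (u i) * complex.Re (u j)) +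
       \sum_i \sum_j A i j * (complex.Im (u i) * complex.Im (u j))).
Proof.
move=> As; pose a i := complex.Re (u i); pose b i := complex.Im (u i).
have uE i j : u i * Num.conj (u j) =
  toC (a i * a j) + toC (b i * b j) + 'i%C * toC (b i * a j - a i * b j).
  rewrite /a /b; case: (u i) (u j) => [x y] [x' y'].
  by apply/eqP; rewrite eq_complex /=; apply/andP; split; apply/eqP; ring.
transitivity (toC (\sum_i \sum_j A i j * (a i * a j) + \sum_i \sum_j A i j * (b i * b j)) +
   'i%C * toC (\sum_i \sum_j A i j * (b i * a j) - \sum_i \sum_j A i j * (a i * b j))).
  rewrite rmorphD rmorphB !rmorph_sum -big_split -sumrB mulr_sumr -big_split /=.
  apply: eq_bigr => i _; rewrite !rmorph_sum -big_split -sumrB mulr_sumr -big_split /=.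
  by apply: eq_bigr => j _; rewrite uE !rmorphM !rmorphB !rmorphM /=; ring.
rewrite [X in _ - X]exchange_big /= [X in _ - X](eq_bigr (fun i => \sum_j A i j * (b i * a j))).
  by rewrite subrr rmorph0 mulr0 addr0.
by move=> i _; apply: eq_bigr => j _; rewrite As (mulrC (a j)).
Qed.

Variables (b r : nat) (e : (d + b)%N = r).

(** The complex bound reads [(1 - 2 c) S <= K1 (1 - c) |v|^2] for the pairing [S]. Adding
    [2 (1 - c)] times the crude bound [S >= - K2 |v|^2] gives an estimate
    for every value of [c]. *)
Lemma de_finetti_real (A : idx n (d + d) -> R) (v : idx n r -> R) (K1 K2 : R) :
  (0 < n)%N -> count_sym A -> count_sym v ->
  (forall x, 0 <= \sum_w A w * mon x w) ->
  (forall u : idx n d -> R, count_sym u ->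
     - K2 * (\sum_i u i ^+ 2) <= \sum_i \sum_j A (join_word erefl i j) * (u i * u j)
     <= K1 * \sum_i u i ^+ 2) ->
  0 <= K1 -> 0 <= K2 ->
  - ((K1 + 2%:R * K2) * (d%:R * (n%:R - 1) / (r%:R + 1)) * \sum_K v K ^+ 2) <=
  \sum_i \sum_j A (join_word erefl i j) * reduced e v i j.
Proof.
move=> n0 As vs Apos AK K10 K20.
have Ajoin i j : A (join_word erefl i j) = A (join_word erefl j i).
  by apply: As; apply/ffunP => l; rewrite !cnt_join !ffunE addnC.
have [J [wt [nd rule]]] := moment_rule_exists C (r + d + d).
have := @de_finetti_bound C n d r (fun K => toC (v K)) J wt nd _ rule
  (fun K => conj_toC (v K)) _ b e (fun w => toC (A w)) (toC K1).
have vC : count_sym (fun K => toC (v K)) by move=> i j eij; rewrite (vs i j).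
have AC : count_sym (fun K => toC (A K)) by move=> i j eij; rewrite (As i j).
have ApC x : (forall l : 'I_n, x l \is Num.real) -> 0 <= \sum_w toC (A w) * mon x w.
  by move=> /real_fun[y xy]; rewrite (form_toC _ xy) ler0c.
have AKC (u : idx n d -> C) : count_sym u ->
  \sum_i \sum_j toC (A (join_word erefl i j)) * (u i * Num.conj (u j)) <= toC K1 * \sum_i u
    i * Num.conj (u i).
  move=> us; rewrite (@herm_real (fun i j => A (join_word erefl i j))) //.
  have -> : \sum_i u i * Num.conj (u i) =
    toC (\sum_i complex.Re (u i) ^+ 2 + \sum_i complex.Im (u i) ^+ 2).
    rewrite rmorphD !rmorph_sum -big_split; apply: eq_bigr => i _ /=.
    by case: (u i) => x y; apply/eqP; rewrite eq_complex /=; apply/andP; split; apply/eqP; ring.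
  rewrite -rmorphM /= lecR mulrDr lerD //.
    by apply: (proj2 (andP (AK (fun i => complex.Re (u i)) _))) => i j eij; rewrite (us i j).
  by apply: (proj2 (andP (AK (fun i => complex.Im (u i)) _))) => i j eij; rewrite (us i j).
move=> /(_ vC AC ApC AKC (leqnn _)).
pose S := \sum_i \sum_j A (join_word erefl i j) * reduced e v i j.
pose nv := \sum_K v K ^+ 2.
have -> : \sum_i \sum_j toC (A (join_word erefl i j)) * reduced e (fun K =>
  toC (v K)) i j = toC S.
  rewrite /S rmorph_sum; apply: eq_bigr => i _; rewrite rmorph_sum; apply: eq_bigr => j _.
  rewrite rmorphM /=; congr (_ * _); rewrite /reduced rmorph_sum; apply: eq_bigr => k _.
  by rewrite rmorphM.
have -> : \sum_K toC (v K) ^+ 2 = toC nv.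
  by rewrite rmorph_sum; apply: eq_bigr => K _; rewrite rmorphXn.
pose Z : R := (slice_const n d b)%:R; pose Y : R := (cross_const n d r)%:R.
have -> : (slice_const n d b)%:R = toC Z by rewrite rmorph_nat.
have -> : (cross_const n d r)%:R = toC Y by rewrite rmorph_nat.
have -> : 2%:R = toC 2%:R by rewrite rmorph_nat.
rewrite -!(rmorphM, rmorphB) /= lecR => main.
have Z0 : 0 < Z by rewrite ltr0n muln_gt0 rise_gt0 ?fact_gt0.
have [c0 c1 c2] := cratio_bounds R d b n0.
set c := cratio _ _ _ _ in c0 c1 c2.
have YE : Y = c * Z.
  by rewrite /c /cratio -/Z divfK ?gt_eqF // /Y /cross_const -e.
have nv0 : 0 <= nv by apply: sumr_ge0 => K _; rewrite sqr_ge0.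
have low : - K2 * nv <= S.
  have -> : S = \sum_k \sum_i \sum_j A (join_word erefl i j) * (v (join_word e i k) * v
    (join_word e j k)).
    rewrite /S [RHS]exchange_big /=; apply: eq_bigr => i _.
    rewrite exchange_big /=; apply: eq_bigr => j _; by rewrite mulr_sumr.
  rewrite /nv (sum_join e (fun K => v K ^+ 2)) exchange_big /= mulr_sumr.
  apply: ler_sum => k _; apply: (proj1 (andP (AK (fun i => v (join_word e i k)) _))).
  by move=> i j eij; apply: vs; rewrite !cnt_join eij.
have {main} : (1 - 2%:R * c) * S <= K1 * ((1 - c) * nv).
  rewrite -(ler_pM2l Z0); move: main; rewrite natrM -/Y YE.
  rewrite (_ : (Z - 2%:R * (c * Z)) * S = Z * ((1 - 2%:R * c) * S)); last by ring.
  by rewrite (_ : K1 * ((Z - c * Z) * nv) = Z * (K1 * ((1 - c) * nv))); last by ring.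
rewrite -/S -/nv => main.
have q0 : 0 <= 1 - c by rewrite subr_ge0.
have low2 : (1 - c) * (- K2 * nv) <= (1 - c) * S by rewrite ler_wpM2l.
have : (1 - c) * (K1 + 2%:R * K2) * nv <= (d%:R * (n%:R - 1) / (r%:R + 1)) * (K1 + 2%:R *
  K2) * nv.
  rewrite ler_wpM2r // ler_wpM2r //; first by rewrite addr_ge0 // mulr_ge0.
  by rewrite -e.
set D := (_ / _) => D1.
have : (2%:R * c - 1) * S + 2%:R * ((1 - c) * S) = S by ring.
move: main low2 D1; lra.
Qed.

End Real.

(** * Minimum of a form on the sphere *)

Import boolp classical_sets.

Section SphereMinimum.
Import filter topology normedtype derive.
Import numFieldNormedType.Exports.
Local Open Scope classical_set_scope.
Variables (R : realType) (n : nat).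

Lemma form_continuous N (A : idx n N -> R) :
  continuous (fun x : 'rV[R]_n => \sum_w A w * mon (fun l => x 0 l) w : R).
Proof.
apply: continuous_big => [|w _]; first exact: add_continuous.
move=> x; apply: (@continuousM _ _ (fun=> A w) (fun y : 'rV[R]_n => mon (fun l => y 0 l) w)).
  exact: cst_continuous.
move: x; apply: continuous_big => [|k _]; [exact: mul_continuous|exact: coord_continuous].
Qed.

Lemma sphere_min N (A : idx n N -> R) : (0 < n)%N ->
  exists2 c : 'cV[R]_n, \sum_l c l 0 ^+ 2 = 1 &
    forall x : 'cV[R]_n, \sum_l x l 0 ^+ 2 = 1 ->
      \sum_w A w * mon (fun l => c l 0) w <= \sum_w A w * mon (fun l => x l 0) w.
Proof.
move=> n0; pose S := [set x : 'rV[R]_n | \sum_l x 0 l ^+ 2 = 1].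
have S0 : S !=set0.
  exists (delta_mx 0 (Ordinal n0)); rewrite /S /= (bigD1 (Ordinal n0)) //= mxE !eqxx expr1n.
  rewrite big1 ?addr0 // => l /negPf nl; rewrite mxE eqxx nl expr0n //.
have Sc : compact S.
  have box : compact [set x : 'rV[R]_n | forall i, x ord0 i \in `[(-1 : R), (1 : R)]%R].
    apply: (@rV_compact _ _ (fun=> `[(-1 : R), (1 : R)]%classic)) => _; exact: segment_compact.
  apply: subclosed_compact box _; last first.
    move=> x /= Sx i; rewrite in_itv /= -ler_norml -(@ler_pXn2r _ 2) ?nnegrE // expr1n.
    rewrite real_normK ?num_real // -Sx (bigD1 i) //= lerDl sumr_ge0 // => l _.
    exact: sqr_ge0.
  have -> : S = (fun x : 'rV[R]_n => \sum_l x 0 l ^+ 2 : R) @^-1` [set 1] by [].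
  apply: closed_comp; last exact: closed_eq.
  move=> x _; apply: continuous_big => [|l _]; first exact: add_continuous.
  move=> y; apply: (@continuousM _ _ (fun y : 'rV[R]_n => y 0 l) (fun y : 'rV[R]_n => y 0 l)).
    exact: coord_continuous.
  exact: coord_continuous.
have [c cS cmin] := EVT_min_rV S0 Sc (continuous_subspaceT (@form_continuous N A)).
exists c^T.
  by move: cS; rewrite inE => <-; apply: eq_bigr => l _; rewrite mxE.
move=> x xS; have := cmin x^T; rewrite inE.
have e : (fun l => x^T 0 l) = (fun l => x l 0) by apply/funext => l; rewrite mxE.
rewrite e; have -> : (fun l => c^T l 0) = (fun l => c 0 l) by apply/funext => l; rewrite mxE.
apply; rewrite /S /= -xS; by apply: eq_bigr => l _; rewrite mxE.
Qed.
End SphereMinimum.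

(** * Maximally symmetric tensors and the matrix of the squared norm *)

Import mpoly.

Section MaxSym.
Variables (R : realType) (n d : nat).
Implicit Types (A : tmatrix R n d) (x : 'cV[R]_n) (p : mpoly.mpoly n R).

Lemma sum_rank (V : nmodType) (T : finType) (F : 'I_#|T| -> V) :
  \sum_a F a = \sum_(i : T) F (enum_rank i).
Proof. by rewrite (reindex enum_rank) //; apply/onW_bij/enum_rank_bij. Qed.

Definition tensor_form (A : idx n (d + d) -> R) (x : 'I_n -> R) : R := \sum_w A w * mon x w.

Definition tensor_mx (T : idx n (d + d) -> R) : tmatrix R n d :=
  \matrix_(a, b) T (join_word erefl (enum_val a) (enum_val b)).

Lemma as_2dtensor_join A i j :
  as_2dtensor A (join_word erefl i j) = A (enum_rank i) (enum_rank j).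
Proof. by rewrite /as_2dtensor join_word_left join_word_right. Qed.

Lemma tensor_mxK T w : as_2dtensor (tensor_mx T) w = T w.
Proof. by rewrite /as_2dtensor mxE !enum_rankK join_wordK. Qed.

Lemma maximally_symmetricP A : maximally_symmetric A <-> count_sym (as_2dtensor A).
Proof.
split=> [As i j /cnt_eq_permute[s ->]|As s w]; first by rewrite As.
by apply: As; rewrite cnt_permute.
Qed.

Lemma trace_innerE A x :
  trace_inner A (kronpow (x *m x^T) d) = tensor_form (as_2dtensor A) (fun l => x l 0).
Proof.
rewrite /trace_inner /mxtrace /tensor_form (sum_join erefl) sum_rank.
under eq_bigr => j _ do rewrite mxE sum_rank.
rewrite exchange_big /=; apply: eq_bigr => i _; apply: eq_bigr => j _.
rewrite !mxE as_2dtensor_join mon_join !enum_rankK; congr (_ * _).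
rewrite /mon -big_split /=; apply: eq_bigr => k _.
by rewrite mxE big_ord1 mxE.
Qed.

Lemma is_MaxSymP p A : is_MaxSym p A <->
  count_sym (as_2dtensor A) /\ forall x, cvmeval p x =
    tensor_form (as_2dtensor A) (fun l => x l 0).
Proof.
rewrite /is_MaxSym maximally_symmetricP; split=> -[h1 h2]; split=> // x.
  by rewrite h2 trace_innerE.
by rewrite trace_innerE.
Qed.

Lemma tensor_form_inj (A B : idx n (d + d) -> R) : count_sym A -> count_sym B ->
  (forall x : 'cV[R]_n, tensor_form A (fun l => x l 0) = tensor_form B (fun l => x l 0)) ->
    A =1 B.
Proof.
move=> As Bs AB w; apply/eqP; rewrite -subr_eq0; apply/eqP; move: w.
apply: (@tensor_form_eq0 R n _ (fun w => A w - B w)).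
  by move=> i j e; rewrite (As i j) // (Bs i j).
move=> x; under eq_bigr do rewrite mulrBl.
rewrite sumrB; apply/eqP; rewrite subr_eq0; apply/eqP.
have := AB (\col_l x l).
have -> : (fun l => (\col_l x l : 'cV[R]_n) l 0) = x by apply/funext => l; rewrite mxE.
by [].
Qed.

Lemma is_MaxSym_uniq p A B : is_MaxSym p A -> is_MaxSym p B -> A = B.
Proof.
move=> /is_MaxSymP[As Ae] /is_MaxSymP[Bs Be]; apply/matrixP => a b.
have := tensor_form_inj As Bs (fun x =>
  etrans (esym (Ae x)) (Be x)) (join_word erefl (enum_val a) (enum_val b)).
by rewrite !as_2dtensor_join !enum_valK.
Qed.

Lemma MaxSym_eq p A : is_MaxSym p A -> MaxSym d p = A.
Proof.
move=> hA; apply: xget_unique => // B hB; exact: is_MaxSym_uniq hB hA.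
Qed.

(** Each monomial of [p] is spread evenly over the words with its letter counts. *)
Lemma is_MaxSym_exists p : is_form (2 * d)%N p -> exists A, is_MaxSym p A.
Proof.
move=> /mpoly.dhomogP ph.
pose ex (m : mpoly.multinom n) : expo n := [ffun i : 'I_n => mpoly.fun_of_multinom m i].
pose T (w : idx n (d + d)) : R :=
  \sum_(m <- mpoly.msupp p) mpoly.mcoeff m p * (wick_expo (cnt w) (ex m))%:R / (d + d)`!%:R.
exists (tensor_mx T); apply/is_MaxSymP; split.
  by move=> i j e; rewrite !tensor_mxK /T e.
move=> x; rewrite /tensor_form /cvmeval mpoly.mevalE.
under [RHS]eq_bigr do rewrite tensor_mxK mulr_suml.
rewrite exchange_big /=.
apply: eq_big_seq => m mp.
have dm : deg (ex m) = (d + d)%N.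
  have := ph _ mp; rewrite /= mdegE mul2n -addnn => <-; by apply: eq_bigr => i _; rewrite ffunE.
have f0 : (d + d)`!%:R != 0 :> R by rewrite pnatr_eq0 -lt0n fact_gt0.
transitivity (mpoly.mcoeff m p * monx (fun l => x l 0) (ex m) / (d + d)`!%:R * (d + d)`!%:R).
  rewrite divfK //; congr (_ * _); by apply: eq_bigr => i _; rewrite ffunE.
rewrite -[X in _ * X%:R = _](sum_wick_expo dm) natr_sum mulr_sumr; apply: eq_bigr => w _.
rewrite monE /wick_expo; case: eqP => [->|_]; last by rewrite !(mulr0, mul0r).
ring.
Qed.

Lemma MaxSym_spec p : is_form (2 * d)%N p -> is_MaxSym p (MaxSym d p).
Proof. by move=> /is_MaxSym_exists[A hA]; rewrite (MaxSym_eq hA). Qed.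

Lemma gauss_moment_double : (gauss_moment (d + d) * d`! = (d + d)`!)%N.
Proof.
elim: d => // k IH; rewrite addSn addnS gauss_moment_rec /= !factS -IH.
by move: (gauss_moment _) (k`!) => x y; nia.
Qed.

Lemma gauss_moment_double_neq0 : (gauss_moment (d + d))%:R != 0 :> R.
Proof.
rewrite pnatr_eq0; apply: contraTneq (fact_gt0 (d + d)) => e.
by rewrite -gauss_moment_double e.
Qed.

(** The normalized Gaussian moment tensor; by rotation invariance its form is the
    [d]-th power of the squared norm. *)
Definition sqnorm_tensor (w : idx n (d + d)) : R :=
  (gauss_expo (cnt w))%:R / (gauss_moment (d + d))%:R.

Lemma sqnorm_tensor_sym : count_sym sqnorm_tensor.
Proof. by move=> i j e; rewrite /sqnorm_tensor e. Qed.

Lemma form_sqnorm_tensor (y : 'I_n -> R) :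
  tensor_form sqnorm_tensor y = (\sum_l y l ^+ 2) ^+ d.
Proof.
have := @word_sum_gauss R n d y; rewrite /word_sum /tensor_form /sqnorm_tensor.
under [X in _ -> X = _]eq_bigr do rewrite mulrAC.
by rewrite -mulr_suml => ->; rewrite mulrAC divff ?mul1r // gauss_moment_double_neq0.
Qed.

Lemma Mmx_tensor : Mmx R n d = tensor_mx sqnorm_tensor.
Proof.
apply: MaxSym_eq; apply/is_MaxSymP; split.
  by move=> i j e; rewrite !tensor_mxK (sqnorm_tensor_sym e).
move=> x; have -> : as_2dtensor (tensor_mx sqnorm_tensor) =
  sqnorm_tensor by apply/funext => w; rewrite tensor_mxK.
rewrite form_sqnorm_tensor /cvmeval rmorphXn /=; congr (_ ^+ _).
rewrite /sqnorm rmorph_sum; apply: eq_bigr => i _.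
by rewrite rmorphXn /= mpoly.mevalXU.
Qed.

Lemma sqnorm_tensor_lower (u : idx n d -> R) : count_sym u ->
  alpha_coef R d * (\sum_i u i ^+ 2) <=
  \sum_i \sum_j sqnorm_tensor (join_word erefl i j) * (u i * u j).
Proof.
move=> us; have := gauss_form_lower us.
have m0 : 0 < (gauss_moment (d + d))%:R :> R by rewrite lt0r gauss_moment_double_neq0 ler0n.
have -> : \sum_i \sum_j sqnorm_tensor (join_word erefl i j) * (u i * u j) =
  (\sum_i \sum_j (gauss_expo (addx (cnt i) (cnt j)))%:R * u i * u j) / (gauss_moment (d +
    d))%:R.
  rewrite mulr_suml; apply: eq_bigr => i _; rewrite mulr_suml; apply: eq_bigr => j _.
  by rewrite /sqnorm_tensor cnt_join; ring.
rewrite ler_pdivlMr //; congr (_ <= _).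
rewrite mulrAC; congr (_ * _); rewrite /alpha_coef mul2n -addnn.
have c0 : 'C(d + d, d)%:R != 0 :> R by rewrite pnatr_eq0 -lt0n bin_gt0 leq_addr.
apply: (mulIf c0); rewrite mulrAC divfK // -natrX -!natrM; congr (_%:R).
have := bin_fact (leq_addr d d); rewrite addnK -gauss_moment_double.
have := fact_gt0 d; move: ('C(_, _)) (d`!) (gauss_moment _) (2 ^ d)%N => c f m t f0 h.
have : (c * f = m)%N by nia.
nia.
Qed.

Lemma sum_fact_expo_dim : (0 < n)%N ->
  (\sum_(i : idx n d) fact_expo (cnt i) = dim_sym n d * d`!)%N.
Proof.
move=> n0; rewrite sum_fact_expo /dim_sym; have := rise1 n.-1 d.
rewrite /rise add1n prednK // => h.
have e : (n + d - 1 = n.-1 + d)%N by lia.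
have := bin_fact (leq_addl n.-1 d); rewrite addnK e -h => h2.
by apply/eqP; rewrite -(eqn_pmul2r (fact_gt0 n.-1)) -h2 mulnA.
Qed.

(** The projection onto symmetric [d]-tensors, read as a tensor [T] of order [2d], has
    the same form as [M]. So [M] is the symmetrization of [T], whence its inner
    product with [T] is its own squared norm, which is then at most that of [T]. *)
Lemma sqnorm_tensor_frob : (0 < n)%N -> \sum_w sqnorm_tensor w ^+ 2 <= (dim_sym n d)%:R.
Proof.
move=> n0; have f0 m : m`!%:R != 0 :> R by rewrite pnatr_eq0 -lt0n fact_gt0.
pose T (w : idx n (d + d)) : R :=
  (wick (idx_left erefl w : idx n d) (idx_right erefl w : idx n d))%:R / d`!%:R.
have TE i j : T (join_word erefl i j) = (wick i j)%:R / d`!%:R.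
  by rewrite /T join_word_left join_word_right.
pose S w : R := (\sum_w' (wick w' w)%:R * T w') / (d + d)`!%:R.
have Ss : count_sym S.
  by move=> i j e; rewrite /S; congr (_ / _); apply: eq_bigr => w _; rewrite /wick e.
have ms (y : 'I_n -> R) N : count_sym (fun w : idx n N => mon y w : R).
  by move=> i j e; rewrite !monE e.
have SM : S =1 sqnorm_tensor.
  apply: tensor_form_inj => //; first exact: sqnorm_tensor_sym.
  move=> x; rewrite form_sqnorm_tensor /tensor_form /S; set y := fun l => x l 0.
  transitivity (\sum_w T w * mon y w).
    under eq_bigr do rewrite mulrAC mulr_suml mulr_suml.
    rewrite exchange_big /=; apply: eq_bigr => w _.
    transitivity (T w / (d + d)`!%:R * \sum_w' (wick w' w)%:R * mon y w').
      by rewrite mulr_sumr; apply: eq_bigr => w' _; rewrite wickC; ring.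
    by rewrite (wick_sym w (ms y _)) mulrA divfK.
  rewrite (sum_join erefl); transitivity (\sum_(i : idx n d) mon y i ^+ 2).
    apply: eq_bigr => i _.
    transitivity (mon y i / d`!%:R * \sum_(j : idx n d) (wick j i)%:R * mon y j).
      by rewrite mulr_sumr; apply: eq_bigr => j _; rewrite TE mon_join wickC; ring.
    by rewrite (wick_sym i (ms y _)) mulrA divfK // expr2.
  rewrite -[d in RHS]card_ord -prodr_const bigA_distr_bigA /=.
  by apply: eq_bigr => i _; rewrite /mon -prodrXl.
have MT : \sum_w sqnorm_tensor w ^+ 2 = \sum_w sqnorm_tensor w * T w.
  transitivity (\sum_w sqnorm_tensor w * S w); first by apply: eq_bigr => w _; rewrite SM expr2.
  rewrite /S; under eq_bigr do rewrite mulrA mulr_sumr mulr_suml.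
  rewrite exchange_big /=; apply: eq_bigr => w _.
  transitivity (T w / (d + d)`!%:R * \sum_w' (wick w' w)%:R * sqnorm_tensor w').
    by rewrite mulr_sumr; apply: eq_bigr => w' _; rewrite wickC; ring.
  by rewrite (wick_sym w sqnorm_tensor_sym) mulrA divfK // mulrC.
have TT : \sum_w T w ^+ 2 = (dim_sym n d)%:R.
  rewrite (sum_join erefl).
  transitivity ((\sum_(i : idx n d) fact_expo (cnt i))%:R / d`!%:R : R); last first.
    by rewrite sum_fact_expo_dim // natrM mulfK.
  rewrite natr_sum mulr_suml; apply: eq_bigr => i _.
  transitivity ((\sum_(j : idx n d) (wick j i)%:R * (wick j i)%:R) / d`!%:R / d`!%:R : R).
    by rewrite !mulr_suml; apply: eq_bigr => j _; rewrite TE wickC; ring.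
  rewrite (wick_sym i (v := fun j => (wick j i)%:R)); last by move=> j k e;
    rewrite (wick_count_sym i e).
  rewrite (mulrC d`!%:R) mulfK // /wick /wick_expo eqxx //.
have : 0 <= \sum_w (sqnorm_tensor w - T w) ^+ 2 by apply: sumr_ge0 => w _; rewrite sqr_ge0.
have -> : \sum_w (sqnorm_tensor w - T w) ^+ 2 = \sum_w T w ^+ 2 - \sum_w sqnorm_tensor w ^+ 2.
  apply/eqP; rewrite -subr_eq0; apply/eqP.
  transitivity (2%:R * (\sum_w sqnorm_tensor w ^+ 2 - \sum_w sqnorm_tensor w * T w)).
    rewrite -!sumrB mulr_sumr; apply: eq_bigr => w _; ring.
  by rewrite MT subrr mulr0.
by rewrite TT subr_ge0.
Qed.

Lemma sqnorm_tensor_upper (u : idx n d -> R) : (0 < n)%N ->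
  \sum_i \sum_j sqnorm_tensor (join_word erefl i j) * (u i * u j) <=
  Num.sqrt (dim_sym n d)%:R * \sum_i u i ^+ 2.
Proof.
move=> n0; set q := \sum_i _; set nu := \sum_i _ ^+ 2; set s := Num.sqrt _.
have s2 : s ^+ 2 = (dim_sym n d)%:R by rewrite sqr_sqrtr.
have s0 : 0 < s by rewrite sqrtr_gt0 ltr0n bin_gt0; lia.
have nu0 : 0 <= nu by apply: sumr_ge0 => i _; rewrite sqr_ge0.
have [nuz|nup] := eqVneq nu 0.
  have u0 i : u i = 0.
    apply/eqP; rewrite -sqrf_eq0; apply/eqP.
    by apply: (psumr_eq0P _ nuz) => // k _; rewrite sqr_ge0.
  by rewrite nuz mulr0 /q big1 // => i _; rewrite big1 // => j _; rewrite u0 mul0r mulr0.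
have {nu0} nup : 0 < nu by rewrite lt0r nup.
have H : 0 <= \sum_i \sum_j (nu * sqnorm_tensor (join_word erefl i j) - s * (u i * u j)) ^+ 2.
  by apply: sumr_ge0 => i _; apply: sumr_ge0 => j _; rewrite sqr_ge0.
have F := sqnorm_tensor_frob n0; rewrite (sum_join erefl) in F.
have uu : \sum_i \sum_j (u i * u j) ^+ 2 = nu ^+ 2.
  rewrite expr2 {1}/nu mulr_suml; apply: eq_bigr => i _; rewrite mulr_sumr.
  by apply: eq_bigr => j _; rewrite exprMn.
have E : \sum_i \sum_j (nu * sqnorm_tensor (join_word erefl i j) - s * (u i * u j)) ^+ 2 =
   nu ^+ 2 * (\sum_i \sum_j sqnorm_tensor (join_word erefl i j) ^+ 2) - 2%:R * (nu * s) * q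
   + s ^+ 2 * (\sum_i \sum_j (u i * u j) ^+ 2).
  rewrite /q !mulr_sumr -sumrB -big_split; apply: eq_bigr => i _ /=.
  rewrite !mulr_sumr -sumrB -big_split; apply: eq_bigr => j _ /=; ring.
have ns : 0 < 2%:R * (nu * s) by rewrite !mulr_gt0.
rewrite -(ler_pM2l ns).
rewrite -subr_ge0; apply: le_trans H _; rewrite E uu.
have : nu ^+ 2 * (\sum_i \sum_j sqnorm_tensor (join_word erefl i j) ^+ 2) <= nu ^+ 2 * s ^+ 2.
  by rewrite s2 ler_wpM2l ?sqr_ge0.
lra.
Qed.

End MaxSym.

(** * Extremal eigenvalues and lifted quadratic forms *)

Section Extremum.
Variable R : realType.

Lemma set_max_eq (A : set R) a : A a -> ubound A a -> set_max A = a.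
Proof.
move=> Aa ua; apply: xget_unique => // b [Ab ub].
by apply/eqP; rewrite eq_le ua // ub.
Qed.

Lemma set_min_eq (A : set R) a : A a -> lbound A a -> set_min A = a.
Proof.
move=> Aa la; apply: xget_unique => // b [Ab lb].
by apply/eqP; rewrite eq_le lb // la.
Qed.

End Extremum.

Section Eigen.
Variables (R : realType) (m : nat).
Implicit Types (A : 'M[R]_m) (v : 'cV[R]_m).
Notation C := (R[i])%C.

Definition qform A v : R := \sum_i \sum_j A i j * (v i 0 * v j 0).

Lemma qformE A v : (v^T *m A *m v) 0 0 = qform A v.
Proof.
rewrite -mulmxA mxE; apply: eq_bigr => i _; rewrite !mxE mulr_sumr.
by apply: eq_bigr => j _; ring.
Qed.

(** Diagonalize over the complex numbers; the eigenvalues are real, hence eigenvalues of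
    the real matrix, and the largest one bounds the form. *)
Lemma top_eigenvalue A : A^T = A -> (0 < m)%N ->
  exists2 a, eigenvalue A a & forall v, qform A v <= a * \sum_i v i 0 ^+ 2.
Proof.
move=> As m0; pose f := real_complex R.
have Ah : map_mx f A \is hermsymmx.
  apply: realsym_hermsym.
    apply/is_hermitianmxP; rewrite expr0 scale1r map_mx_id //.
    by rewrite map_trmx As.
  by apply/mxOverP => i j; rewrite mxE complex_real.
have [P [D [PP Dr _ De Dk]]] := hermitian_spectrum Ah.
pose a s := complex.Re (D s).
have aE s : D s = f (a s) by rewrite /f RRe_real.
have ev s : eigenvalue A (a s).
  suff : eigenvalue (map_mx f A) (f (a s)) by rewrite (eigenvalue_map f).
  rewrite -aE; apply/eigenvalueP.
  by have [u u0 uA] := De s; exists u.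
pose s0 := [arg max_(s > Ordinal m0) a s]%O.
have as0 s : a s <= a s0.
  by rewrite /s0; case: arg_maxP => // t _ h; apply: h.
exists (a s0) => // v; rewrite -lecR rmorphM /=.
pose y s := \sum_j P s j * f (v j 0).
have yE g : \sum_i \sum_j (\sum_s (P s i)^* * g s * P s j) * (f (v i 0) * f (v j 0)) =
    \sum_s g s * (y s * (y s)^*).
  transitivity (\sum_i \sum_j \sum_s (P s i)^* * g s * P s j * (f (v i 0) * f (v j 0))).
    by apply: eq_bigr => i _; apply: eq_bigr => j _; rewrite mulr_suml.
  under eq_bigr do rewrite exchange_big /=.
  rewrite exchange_big /=; apply: eq_bigr => s _.
  rewrite /y rmorph_sum mulrC mulr_sumr mulr_suml; apply: eq_bigr => i _.
  rewrite !mulr_suml; apply: eq_bigr => j _.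
  rewrite rmorphM /= (_ : (f (v i 0))^* = f (v i 0)); last exact: conj_toC.
  ring.
have -> : (qform A v)%:C%C = \sum_s D s * (y s * (y s)^*).
  rewrite -yE /qform rmorph_sum; apply: eq_bigr => i _; rewrite rmorph_sum.
  apply: eq_bigr => j _; rewrite !rmorphM /=; congr (_ * _).
  transitivity ((map_mx f A ^+ 1) i j); [by rewrite expr1 mxE|rewrite Dk].
  by apply: eq_bigr => s _; rewrite expr1.
have -> : (\sum_i v i 0 ^+ 2)%:C%C = \sum_s 1 * (y s * (y s)^*).
  rewrite -(yE (fun=> 1)) rmorph_sum; apply: eq_bigr => i _.
  have PP1 j : \sum_s (P s i)^* * 1 * P s j = (i == j)%:R.
    by rewrite -PP; apply: eq_bigr => s _; rewrite mulr1.
  rewrite (bigD1 i) //= PP1 eqxx mul1r big1 ?addr0; first by rewrite expr2 rmorphM.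
  by move=> j ji; rewrite PP1 eq_sym (negPf ji) mul0r.
rewrite mulr_sumr; apply: ler_sum => s _; rewrite mul1r ler_wpM2r ?mul_conjC_ge0 //.
by rewrite aE /f lecR.
Qed.

Lemma eigenvalue_le A (c a : R) : (forall v, qform A v <= c * \sum_i v i 0 ^+ 2) ->
  eigenvalue A a -> a <= c.
Proof.
move=> h /eigenvalueP[u uA u0].
have := h u^T; rewrite -qformE trmxK uA -scalemxAl mxE.
have e : (u *m u^T) 0 0 = \sum_i u^T i 0 ^+ 2.
  by rewrite mxE; apply: eq_bigr => i _; rewrite !mxE expr2.
rewrite e ler_pM2r // lt0r sumr_ge0 ?andbT; last by move=> i _; rewrite sqr_ge0.
apply: contra_neq u0 => s0; apply/rowP => i; rewrite mxE; apply/eqP.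
rewrite -sqrf_eq0; apply/eqP; have : u^T i 0 ^+ 2 = 0.
  by apply: (psumr_eq0P _ s0) => // k _; rewrite sqr_ge0.
by rewrite mxE.
Qed.

Lemma lambda_maxP A : A^T = A -> (0 < m)%N ->
  (forall v, qform A v <= lambda_max A * \sum_i v i 0 ^+ 2) /\
  (forall a, eigenvalue A a -> a <= lambda_max A).
Proof.
move=> As m0; have [a Aa h] := top_eigenvalue As m0.
rewrite /lambda_max (@set_max_eq _ _ a) //; last first.
  by move=> b /= Ab; apply: eigenvalue_le h Ab.
by split=> // b Ab; apply: eigenvalue_le h Ab.
Qed.

Lemma eigenvalueN A a : eigenvalue (- A) (- a) = eigenvalue A a.
Proof.
apply/eigenvalueP/eigenvalueP => -[u uA u0]; exists u => //.
  by apply: oppr_inj; rewrite -mulmxN uA scaleNr.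
by rewrite mulmxN uA scaleNr.
Qed.

Lemma qformN A v : qform (- A) v = - qform A v.
Proof.
rewrite /qform -sumrN; apply: eq_bigr => i _; rewrite -sumrN.
by apply: eq_bigr => j _; rewrite mxE mulNr.
Qed.

Lemma lambda_minP A : A^T = A -> (0 < m)%N ->
  (forall v, lambda_min A * \sum_i v i 0 ^+ 2 <= qform A v) /\
  (forall a, eigenvalue A a -> lambda_min A <= a).
Proof.
move=> As m0; have [|h1 h2] := @lambda_maxP (- A) _ m0; first by rewrite raddfN /= As.
have [|a Aa h] := @top_eigenvalue (- A) _ m0; first by rewrite raddfN /= As.
have eNa : eigenvalue A (- a) by rewrite -eigenvalueN opprK.
have lb b : eigenvalue A b -> - a <= b.
  by rewrite -eigenvalueN => Ab; have := eigenvalue_le h Ab; rewrite lerNl.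
rewrite /lambda_min (@set_min_eq _ _ (- a)) //.
split=> // v; have := h v; rewrite qformN; lra.
Qed.

End Eigen.

Section SymProj.
Variables (R : realType) (n r : nat).
Notation Pi := (sym_proj R n r).

Definition entries (v : tensor R n r) (i : idx n r) : R := v (enum_rank i) 0.

Definition of_entries (u : idx n r -> R) : tensor R n r := \col_a u (enum_val a).

Lemma of_entriesK u i : entries (of_entries u) i = u i.
Proof. by rewrite /entries mxE enum_rankK. Qed.

Lemma symmetric_tensorP v : symmetric_tensor v <-> count_sym (entries v).
Proof.
split=> [vs i j /cnt_eq_permute[s ->]|vs s i]; first by rewrite /entries vs.
by apply: vs; rewrite cnt_permute.
Qed.

(** The average over permutations, written with the Wick kernel, is such a projection. *)
Lemma sym_projP : is_orthogonal_projection (@symmetric_tensor R n r) Pi.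
Proof.
apply: (xgetPex 0).
pose P : tmatrix R n r := \matrix_(a, b)
  ((wick (enum_val b : idx n r) (enum_val a : idx n r))%:R / r`!%:R).
have f0 : r`!%:R != 0 :> R by rewrite pnatr_eq0 -lt0n fact_gt0.
have PE v i : entries (P *m v) i = (\sum_j (wick j i)%:R * entries v j) / r`!%:R.
  rewrite /entries mxE sum_rank mulr_suml; apply: eq_bigr => j _.
  by rewrite mxE !enum_rankK; ring.
exists P => v; split.
  apply/symmetric_tensorP => i j e; rewrite !PE; congr (_ / _).
  by apply: eq_bigr => k _; rewrite /wick e.
move=> u /symmetric_tensorP us; apply/matrixP => a b; rewrite !ord1 mxE [RHS]mxE.
rewrite sum_rank.
transitivity (\sum_i entries u i * entries v i - \sum_i entries u i * entries (P *m v) i).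
  by rewrite -sumrB; apply: eq_bigr => i _; rewrite !mxE /entries mxE mulrBr.
apply/eqP; rewrite subr_eq0; apply/eqP;
  under [RHS]eq_bigr do rewrite PE mulrA mulr_sumr mulr_suml.
rewrite exchange_big /=; apply: eq_bigr => j _.
transitivity ((\sum_i (wick i j)%:R * entries u i) * entries v j / r`!%:R).
  by rewrite wick_sym // mulrAC (mulrC r`!%:R) mulfK.
by rewrite !mulr_suml; apply: eq_bigr => i _; rewrite wickC; ring.
Qed.

Lemma sym_proj_sym v : count_sym (entries (Pi *m v)).
Proof. by apply/symmetric_tensorP; have [] := sym_projP v. Qed.

Lemma sym_proj_id v : count_sym (entries v) -> Pi *m v = v.
Proof.
move=> /symmetric_tensorP vs; have [Pvs ort] := sym_projP v.
have dv : symmetric_tensor (v - Pi *m v).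
  by move=> s i; rewrite !mxE vs; congr (_ - _); have := Pvs s i; rewrite !mxE.
have /matrixP/(_ 0 0) := ort _ dv; rewrite [RHS]mxE mxE => e0.
apply/colP => a; apply/eqP; rewrite eq_sym -subr_eq0 -sqrf_eq0; apply/eqP.
have s0 : \sum_a (v - Pi *m v) a 0 ^+ 2 = 0.
  by rewrite -[RHS]e0; apply: eq_bigr => i _; rewrite [X in _ = X * _]mxE expr2.
have : (v - Pi *m v) a 0 ^+ 2 = 0.
  by apply: (psumr_eq0P _ s0) => // k _; rewrite sqr_ge0.
by rewrite [X in X ^+ 2]mxE [X in _ + X]mxE.
Qed.

Lemma sym_proj_tr : Pi^T = Pi.
Proof.
have H (u v : tensor R n r) : (Pi *m u)^T *m v = (Pi *m u)^T *m (Pi *m v).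
  have [Pus _] := sym_projP u; have [_ ort] := sym_projP v.
  by apply/eqP; rewrite -subr_eq0 -mulmxBr; apply/eqP/ort.
have e : Pi^T = Pi^T *m Pi.
  apply/matrixP => a b.
  have := H (delta_mx a 0) (delta_mx b 0); move=> /matrixP/(_ 0 0).
  rewrite !trmx_mul trmx_delta -!mulmxA.
  have dE (X : tmatrix R n r) : ((delta_mx 0 a : 'rV_ _) *m (X *m (delta_mx b 0 : 'cV_ _)))
    0 0 = X a b.
    by rewrite -rowE mxE -colE mxE.
  by rewrite dE (mulmxA Pi^T) dE.
by rewrite -[RHS]trmxK e trmx_mul trmxK -e.
Qed.

End SymProj.

Section Lift.
Variables (R : realType) (n d r : nat) (le_dr : (d <= r)%N).
Notation e := (subnKC le_dr).

Definition lifted_quad_mx (A : tmatrix R n d) (u : idx n r -> R) : R :=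
  \sum_i \sum_j A (enum_rank i) (enum_rank j) * reduced e u i j.

(** The identity on the last [r - d] legs contracts them, leaving the partial trace. *)
Lemma kron_id_form A (v : tensor R n r) :
  qform (kron e A (kronpow 1%:M (r - d))) v = lifted_quad_mx A (entries v).
Proof.
rewrite /qform sum_rank.
under eq_bigr do rewrite sum_rank.
rewrite /lifted_quad_mx (sum_join e); apply: eq_bigr => i _.
under eq_bigr => k _ do rewrite (sum_join e).
rewrite exchange_big /=; apply: eq_bigr => j _.
rewrite /reduced mulr_sumr; apply: eq_bigr => k _.
rewrite (bigD1 k) //= big1 ?addr0 => [|l lk].
  rewrite !mxE !enum_rankK !join_word_left !join_word_right ?mxE ?enum_rankK.
  by rewrite big1 ?mulr1 // => s _; rewrite mxE eqxx.
rewrite !mxE !enum_rankK !join_word_left !join_word_right ?mxE ?enum_rankK.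
have [s ls] : exists s, k s != l s.
  apply/existsP; rewrite -negb_forall; apply: contra lk => /forallP h.
  by apply/eqP/ffunP => s; apply/eqP; rewrite eq_sym.
by rewrite (bigD1 s) //= mxE (negPf ls) !(mul0r, mulr0).
Qed.

Lemma kron_id_tr A : A^T = A ->
  (kron e A (kronpow 1%:M (r - d)))^T = kron e A (kronpow 1%:M (r - d)) :> tmatrix R n r.
Proof.
move=> As; apply/matrixP => a b; rewrite !mxE -{1}As mxE; congr (_ * _).
by apply: eq_bigr => k _; rewrite !mxE eq_sym.
Qed.

Lemma lift_sym_form A (v : tensor R n r) :
  qform (lift_sym le_dr A) v = lifted_quad_mx A (entries (sym_proj R n r *m v)).
Proof.
rewrite -kron_id_form -!qformE /lift_sym trmx_mul sym_proj_tr.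
by rewrite !mulmxA.
Qed.

Lemma qform_lin m (A B : 'M[R]_m) nu v : qform (A - nu *: B) v = qform A v - nu * qform B v.
Proof.
rewrite /qform mulr_sumr -sumrB; apply: eq_bigr => i _.
rewrite mulr_sumr -sumrB; apply: eq_bigr => j _; rewrite !mxE; ring.
Qed.

Lemma psd_lift (A B : tmatrix R n d) nu : A^T = A -> B^T = B ->
  psd (lift_sym le_dr A - nu *: lift_sym le_dr B) <->
  forall u : idx n r -> R, count_sym u -> nu * lifted_quad_mx B u <= lifted_quad_mx A u.
Proof.
move=> As Bs.
have Ls (X : tmatrix R n d) : X^T = X -> (lift_sym le_dr X)^T = lift_sym le_dr X.
  by move=> Xs; rewrite /lift_sym !trmx_mul sym_proj_tr kron_id_tr // mulmxA.
split=> [[_ h] u us|h].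
  have := h (of_entries u); rewrite qformE qform_lin !lift_sym_form sym_proj_id.
    by rewrite (_ : entries (of_entries u) = u) ?subr_ge0 //; apply/funext => i;
      rewrite of_entriesK.
  by move=> i j eij; rewrite !of_entriesK (us i j).
split; first by rewrite linearB linearZ /= !Ls.
move=> v; rewrite qformE qform_lin !lift_sym_form subr_ge0; apply: h.
exact: sym_proj_sym.
Qed.

End Lift.

(** * The bound on the spectral gap *)

Section Bound.
Variables (R : realType) (n d : nat) (p : mpoly.mpoly n R).
Hypotheses (n0 : (0 < n)%N) (d0 : (0 < d)%N) (ph : is_form (2 * d)%N p).
Notation Q := (Qmx d p).
Notation M := (Mmx R n d).
Notation Qt := (as_2dtensor Q).
Notation Mt := (@sqnorm_tensor R n d).
Notation alpha := (alpha_coef R d).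
Notation sN := (Num.sqrt (dim_sym n d)%:R : R).

Lemma Qmx_sym : count_sym Qt.
Proof. by have /is_MaxSymP[] := MaxSym_spec ph. Qed.

Lemma Qmx_form (x : 'cV[R]_n) : cvmeval p x = tensor_form Qt (fun l => x l 0).
Proof. by have /is_MaxSymP[_ ->] := MaxSym_spec ph. Qed.

Lemma norm2_eq1 (x : 'cV[R]_n) : norm2 x = 1 <-> \sum_i x i 0 ^+ 2 = 1.
Proof.
rewrite /norm2; split=> [e|->]; last exact: sqrtr1.
rewrite -[LHS]sqr_sqrtr ?e ?expr1n // sumr_ge0 // => i _; exact: sqr_ge0.
Qed.

Lemma count_sym_tr (A : tmatrix R n d) : count_sym (as_2dtensor A) -> A^T = A.
Proof.
move=> As; apply/matrixP => a b; rewrite mxE -(enum_valK a) -(enum_valK b).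
rewrite -!as_2dtensor_join; apply: As; apply/ffunP => l.
by rewrite !cnt_join !ffunE addnC.
Qed.

Lemma pminP : exists x0 : 'cV[R]_n, [/\ \sum_i x0 i 0 ^+ 2 = 1,
  tensor_form Qt (fun l => x0 l 0) = pmin p &
  forall x : 'cV[R]_n, \sum_i x i 0 ^+ 2 = 1 -> pmin p <= tensor_form Qt (fun l => x l 0)].
Proof.
have [x0 x01 x0min] := sphere_min Qt n0; exists x0.
have -> : pmin p = tensor_form Qt (fun l => x0 l 0).
  apply: set_min_eq; first by exists x0; rewrite ?Qmx_form //=; apply/norm2_eq1.
  by move=> _ [x /norm2_eq1 x1 <-]; rewrite Qmx_form; apply: x0min.
by split.
Qed.

Lemma form_scale (A : idx n (d + d) -> R) c (x : 'I_n -> R) :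
  tensor_form A (fun l => c * x l) = c ^+ (d + d) * tensor_form A x.
Proof.
rewrite /tensor_form mulr_sumr; apply: eq_bigr => w _.
by rewrite /mon big_split /= prodr_const card_ord; ring.
Qed.

Definition gap (w : idx n (d + d)) : R := Qt w - pmin p * Mt w.

Lemma gap_sym : count_sym gap.
Proof. by move=> i j e; rewrite /gap (Qmx_sym e) (sqnorm_tensor_sym R e). Qed.

Lemma form_gap x : tensor_form gap x = tensor_form Qt x - pmin p * tensor_form Mt x.
Proof.
rewrite /tensor_form mulr_sumr -sumrB; apply: eq_bigr => w _; rewrite /gap; ring.
Qed.

(** Off the origin, scale to the unit sphere, where [pmin p] is the minimum. *)
Lemma gap_ge0 x : 0 <= tensor_form gap x.
Proof.
have [x0 [_ _ xmin]] := pminP.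
pose s := \sum_l x l ^+ 2.
have s0 : 0 <= s by apply: sumr_ge0 => l _; rewrite sqr_ge0.
have [sz|snz] := eqVneq s 0.
  have x_0 l : x l = 0.
    apply/eqP; rewrite -sqrf_eq0; apply/eqP.
    by apply: (psumr_eq0P _ sz) => // k _; rewrite sqr_ge0.
  rewrite /tensor_form big1 // => w _.
  by rewrite /mon (bigD1 (Ordinal (ltn_addr d d0))) //= x_0 mul0r mulr0.
have N0 : Num.sqrt s != 0 by rewrite gt_eqF // sqrtr_gt0 lt0r snz.
have e : x = (fun l => Num.sqrt s * (x l / Num.sqrt s)).
  by apply/funext => l; rewrite mulrCA divff // mulr1.
rewrite e form_scale mulr_ge0 //; first by rewrite exprn_ge0 // sqrtr_ge0.
rewrite form_gap form_sqnorm_tensor; set y := fun l => _.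
have y1 : \sum_l y l ^+ 2 = 1.
  rewrite /y; under eq_bigr do rewrite expr_div_n.
  by rewrite -mulr_suml sqr_sqrtr // divff.
rewrite y1 expr1n mulr1 subr_ge0.
have -> : y = (fun l => (\col_l y l : 'cV[R]_n) l 0) by apply/funext => l; rewrite mxE.
by apply: xmin; rewrite -[RHS]y1; apply: eq_bigr => l _; rewrite mxE.
Qed.

Definition quad (A : idx n (d + d) -> R) (u : idx n d -> R) : R :=
  \sum_i \sum_j A (join_word erefl i j) * (u i * u j).

Lemma quad_lin (A B : idx n (d + d) -> R) c u :
  quad (fun w => A w - c * B w) u = quad A u - c * quad B u.
Proof.
rewrite /quad mulr_sumr -sumrB; apply: eq_bigr => i _.
rewrite mulr_sumr -sumrB; apply: eq_bigr => j _; ring.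
Qed.

Lemma quad_gap u : quad gap u = quad Qt u - pmin p * quad Mt u.
Proof. exact: quad_lin. Qed.

Lemma qform_quad (A : tmatrix R n d) u : qform A (of_entries u) = quad (as_2dtensor A) u.
Proof.
rewrite /qform sum_rank; apply: eq_bigr => i _; rewrite sum_rank.
by apply: eq_bigr => j _; rewrite as_2dtensor_join -!/(entries _ _) !of_entriesK.
Qed.

Lemma sum_of_entries (u : idx n d -> R) : \sum_a of_entries u a 0 ^+ 2 = \sum_i u i ^+ 2.
Proof. by rewrite sum_rank; apply: eq_bigr => i _; rewrite -/(entries _ _) of_entriesK. Qed.

Lemma card_idx_gt0 : (0 < #|{: idx n d}|)%N.
Proof. by apply/card_gt0P; exists [ffun=> Ordinal n0]. Qed.

Lemma quad_lambda u :
  lambda_min Q * \sum_i u i ^+ 2 <= quad Qt u <= lambda_max Q * \sum_i u i ^+ 2.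
Proof.
have Qs := count_sym_tr Qmx_sym.
have [h1 _] := lambda_maxP Qs card_idx_gt0; have [h2 _] := lambda_minP Qs card_idx_gt0.
by have := h1 (of_entries u); have := h2 (of_entries u);
  rewrite qform_quad sum_of_entries => -> ->.
Qed.

Lemma quad_mon (A : idx n (d + d) -> R) (x : 'I_n -> R) :
  quad A (fun i => mon x i) = tensor_form A x.
Proof.
rewrite /quad /tensor_form (sum_join erefl); apply: eq_bigr => i _; apply: eq_bigr => j _.
by rewrite mon_join.
Qed.

Lemma mon_sym N (x : 'I_n -> R) : count_sym (fun i : idx n N => mon x i).
Proof. by move=> i j e; rewrite !monE e. Qed.

Lemma sum_mon2 N (x : 'I_n -> R) :
  \sum_(i : idx n N) mon x i ^+ 2 = (\sum_l x l ^+ 2) ^+ N.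
Proof.
rewrite -[N in RHS]card_ord -prodr_const bigA_distr_bigA /=.
by apply: eq_bigr => i _; rewrite /mon -prodrXl.
Qed.

Lemma alpha_gt0 : 0 < alpha.
Proof. by rewrite divr_gt0 ?exprn_gt0 // ltr0n bin_gt0; rewrite leq_pmull. Qed.

Section Level.
Variables (r : nat) (le_dr : (d <= r)%N).
Notation e := (subnKC le_dr).

Definition lifted_quad (A : idx n (d + d) -> R) (u : idx n r -> R) : R :=
  \sum_i \sum_j A (join_word erefl i j) * reduced e u i j.

Lemma lifted_quad_mxE (A : tmatrix R n d) u :
  lifted_quad_mx le_dr A u = lifted_quad (as_2dtensor A) u.
Proof.
by apply: eq_bigr => i _; apply: eq_bigr => j _; rewrite as_2dtensor_join.
Qed.

Lemma as_2dtensor_Mmx : as_2dtensor M = Mt.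
Proof. by apply/funext => w; rewrite Mmx_tensor tensor_mxK. Qed.

Definition feasible (nu : R) : Prop :=
  forall u : idx n r -> R, count_sym u -> nu * lifted_quad Mt u <= lifted_quad Qt u.

Lemma psd_feasible nu :
  psd (lift_sym le_dr Q - nu *: lift_sym le_dr M) <-> feasible nu.
Proof.
rewrite psd_lift; [|exact: count_sym_tr Qmx_sym|apply: count_sym_tr;
  rewrite as_2dtensor_Mmx; exact: sqnorm_tensor_sym].
by split=> h u us; have := h u us; rewrite !lifted_quad_mxE as_2dtensor_Mmx.
Qed.

Lemma lifted_quad_slices A u :
  lifted_quad A u = \sum_k quad A (fun i => u (join_word e i k)).
Proof.
rewrite /lifted_quad /quad [RHS]exchange_big /=; apply: eq_bigr => i _.
rewrite [RHS]exchange_big /=; apply: eq_bigr => j _.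
by rewrite /reduced mulr_sumr.
Qed.

Lemma slice_sym (u : idx n r -> R) k : count_sym u -> count_sym (fun i => u (join_word e i k)).
Proof. by move=> us i j eij; apply: us; rewrite !cnt_join eij. Qed.

Lemma sum_slices (u : idx n r -> R) :
  \sum_K u K ^+ 2 = \sum_k \sum_i u (join_word e i k) ^+ 2.
Proof. by rewrite (sum_join e (fun K => u K ^+ 2)) exchange_big. Qed.

Lemma lifted_quad_sqnorm_lower u : count_sym u -> alpha * \sum_K u K ^+ 2 <= lifted_quad Mt u.
Proof.
move=> us; rewrite lifted_quad_slices sum_slices mulr_sumr; apply: ler_sum => k _.
exact/sqnorm_tensor_lower/slice_sym.
Qed.

Lemma lifted_quad_sqnorm_ge0 u : count_sym u -> 0 <= lifted_quad Mt u.
Proof.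
move=> us; apply: le_trans (lifted_quad_sqnorm_lower us); apply: mulr_ge0;
  first exact/ltW/alpha_gt0.
by apply: sumr_ge0 => K _; rewrite sqr_ge0.
Qed.

Lemma lifted_quad_mon A (x : 'I_n -> R) : \sum_l x l ^+ 2 = 1 ->
  lifted_quad A (fun K => mon x K) = tensor_form A x.
Proof.
move=> x1; rewrite lifted_quad_slices -quad_mon.
transitivity (\sum_(k : idx n (r - d)) mon x k ^+ 2 * quad A (fun i => mon x i)).
  apply: eq_bigr => k _; rewrite /quad mulr_sumr; apply: eq_bigr => i _.
  by rewrite mulr_sumr; apply: eq_bigr => j _; rewrite !mon_join; ring.
by rewrite -mulr_suml sum_mon2 x1 expr1n mul1r.
Qed.

(** Test with the [r]-th power of a minimizer on the sphere. *)
Lemma feasible_le nu : feasible nu -> nu <= pmin p.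
Proof.
have [x0 [x01 x0p _]] := pminP => h.
have := h _ (@mon_sym r (fun l => x0 l 0)).
by rewrite !lifted_quad_mon // x0p form_sqnorm_tensor x01 expr1n mulr1.
Qed.

(** The feasible set is closed, and bounded by [pmin p]; the given member settles the
    tensors at which the form of [M] vanishes. *)
Lemma spectral_boundP : (exists nu, feasible nu) ->
  feasible (spectral_bound le_dr p) /\
  forall nu, feasible nu -> nu <= spectral_bound le_dr p.
Proof.
move=> [nu0 nu0f]; pose S : set R := [set nu | feasible nu]%classic.
have Sub : has_ubound S by exists (pmin p) => nu; apply: feasible_le.
have supf : feasible (sup S).
  move=> u us; have := lifted_quad_sqnorm_ge0 us; rewrite le_eqVlt => /orP[/eqP m0|m0].
    by have := nu0f u us; rewrite -m0 !mulr0.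
  rewrite -ler_pdivlMr //; apply: ge_sup; first by exists nu0.
  by move=> nu nuf; rewrite ler_pdivlMr //; apply: nuf.
have supu nu : feasible nu -> nu <= sup S by move=> h; apply: ub_le_sup.
have -> : spectral_bound le_dr p = sup S.
  apply: set_max_eq => /=; first exact/psd_feasible.
  by move=> nu /= /psd_feasible; apply: supu.
by split.
Qed.

End Level.

Lemma lifted_quad_self (A : idx n (d + d) -> R) u : count_sym u ->
  lifted_quad (leqnn d) A u = quad A u.
Proof.
move=> us; apply: eq_bigr => i _; apply: eq_bigr => j _; congr (_ * _).
rewrite /reduced; move: (subnKC (leqnn d)); have : (d - d = 0)%N by rewrite subnn.
move: (d - d)%N => b b0; subst b => e.
(* Here no leg is contracted: only the empty word remains. *)
have w0 : idx n 0 by apply: finfun => -[].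
rewrite (sum_word0 _ w0).
have h i' : u (join_word e i' w0) = u i'.
  by apply: us; rewrite cnt_join cnt_word0; apply/ffunP => l; rewrite !ffunE addn0.
by rewrite !h.
Qed.

Notation spec_d := (spectral_bound (leqnn d) p).
Notation g := (gammaQ d p).

Lemma spec_d_quad u : count_sym u -> spec_d * quad Mt u <= quad Qt u.
Proof.
move=> us; rewrite -!lifted_quad_self //; apply: (proj1 (spectral_boundP _)) => //.
(* A feasible value exists since the form of M is at least alpha. *)
exists (- (`|lambda_min Q| / alpha)) => w ws; rewrite !lifted_quad_self //.
have a0 := alpha_gt0.
have h1 : `|lambda_min Q| * \sum_i w i ^+ 2 <= `|lambda_min Q| / alpha * quad Mt w.
  by rewrite -mulrA ler_wpM2l // ler_pdivlMl //; apply: sqnorm_tensor_lower.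
have /andP[h2 _] := quad_lambda w.
have h3 : - `|lambda_min Q| * \sum_i w i ^+ 2 <= lambda_min Q * \sum_i w i ^+ 2.
  rewrite ler_wpM2r ?sumr_ge0 // => [i _|]; first exact: sqr_ge0.
  by rewrite lerNl -normrN ler_norm.
move: h1 h2 h3; lra.
Qed.

Lemma spec_d_le : spec_d <= pmin p.
Proof.
apply: (@feasible_le d (leqnn d)) => u us; rewrite !lifted_quad_self //; exact: spec_d_quad.
Qed.

Lemma lambda_pmin : lambda_min Q <= pmin p <= lambda_max Q.
Proof.
have [x0 [x01 x0p _]] := pminP.
have := quad_lambda (fun i => mon (fun l => x0 l 0) i).
by rewrite quad_mon sum_mon2 x01 expr1n !mulr1 x0p.
Qed.

Lemma gamma_max : lambda_max Q - spec_d <= g.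
Proof. by rewrite le_max lexx. Qed.

Lemma gamma_min : pmin p - lambda_min Q <= g.
Proof. by rewrite le_max lexx orbT. Qed.

Lemma gamma_ge0 : 0 <= g.
Proof. by apply: le_trans gamma_min; have /andP[+ _] := lambda_pmin; rewrite subr_ge0. Qed.

Lemma sqrtN_ge1 : 1 <= sN.
Proof.
rewrite -[leLHS]sqrtr1 ler_sqrt // ler1n bin_gt0; lia.
Qed.

(** The matrix [Q(p)] dominates [spec_d * M] on symmetric tensors, so [gap] dominates
    [- (pmin p - spec_d) * M]. *)
Lemma gap_lower u : count_sym u ->
  - (g * sN) * \sum_i u i ^+ 2 <= quad gap u.
Proof.
move=> us; rewrite quad_gap.
have h1 := spec_d_quad us; have h2 := sqnorm_tensor_upper u n0; rewrite -/(quad _ _) in h2.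
have m0 : 0 <= quad Mt u by rewrite -(lifted_quad_self _ us); apply: lifted_quad_sqnorm_ge0.
have h3 : (pmin p - spec_d) * quad Mt u <= g * quad Mt u.
  rewrite ler_wpM2r //; have := gamma_max; have /andP[_] := lambda_pmin; lra.
have h4 : g * quad Mt u <= g * (sN * \sum_i u i ^+ 2) by rewrite ler_wpM2l ?gamma_ge0.
move: h1 h3 h4; rewrite mulrA; lra.
Qed.

(** Write [gap] as [(Q(p) - pmin p) + pmin p * (1 - M)]; the second term is estimated
    through [0 <= M <= sqrt N] and [1 <= sqrt N], according to the sign of [pmin p]. *)
Lemma gap_upper u : count_sym u ->
  quad gap u <= (g + `|pmin p| * sN) * \sum_i u i ^+ 2.
Proof.
move=> us; rewrite quad_gap; set nu := \sum_i _.
have h2 := sqnorm_tensor_upper u n0; rewrite -/(quad _ _) -/nu in h2.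
have m0 : 0 <= quad Mt u by rewrite -(lifted_quad_self _ us); apply: lifted_quad_sqnorm_ge0.
have nu0 : 0 <= nu by apply: sumr_ge0 => i _; rewrite sqr_ge0.
have /andP[_ h1] := quad_lambda u; rewrite -/nu in h1.
have h3 : (lambda_max Q - pmin p) * nu <= g * nu.
  rewrite ler_wpM2r //; have := gamma_max; have := spec_d_le; lra.
have h4 : nu <= sN * nu by rewrite ler_peMl // sqrtN_ge1.
have h5 : pmin p * (nu - quad Mt u) <= `|pmin p| * (sN * nu).
  have [p0|p0] := lerP 0 (pmin p).
    by rewrite ger0_norm // ler_wpM2l //; lra.
  rewrite ltr0_norm // -[leLHS]mulrNN ler_wpM2l ?oppr_ge0 ?(ltW p0) //; lra.
move: h1 h3 h5; rewrite mulrA; lra.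
Qed.

(** Two distinct words with the same letter counts index equal rows of [Q(p)]. *)
Lemma zero_eigenvalue : (1 < n)%N -> (1 < d)%N -> eigenvalue Q 0.
Proof.
move=> n1 d1.
pose a := Ordinal n0; pose b := Ordinal n1; pose s := Ordinal d0; pose t := Ordinal d1.
(* The words baa...a and aba...a. *)
pose i : idx n d := [ffun k => if k == s then b else a].
pose j := permute_idx (tperm s t) i.
have ij : i != j.
  apply/eqP => /ffunP/(_ s); rewrite !ffunE tpermL eqxx.
  by case: eqP => // /(congr1 val).
apply/eigenvalueP; exists (of_entries (fun k => (k == i)%:R - (k == j)%:R))^T; last first.
  apply: contra_neq ij => /rowP/(_ (enum_rank i)); rewrite !mxE enum_rankK eqxx.
  by case: eqP => // _ /eqP; rewrite subr0 oner_eq0.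
apply/rowP => c; rewrite !mxE mul0r sum_rank.
under eq_bigr do rewrite !mxE enum_rankK mulrBl.
have E (i0 : idx n d) : \sum_(k : idx n d) (k == i0)%:R * Q (enum_rank k) c =
  Q (enum_rank i0) c.
  rewrite (bigD1 i0) //= eqxx mul1r big1 ?addr0 // => k /negPf->; exact: mul0r.
rewrite sumrB !E -(enum_valK c) -!as_2dtensor_join; apply/eqP; rewrite subr_eq0; apply/eqP.
by apply: Qmx_sym; rewrite !cnt_join cnt_permute.
Qed.

(** The eigenvalue [0] gives [lambda_min Q <= 0 <= lambda_max Q]. *)
Lemma pmin_le_gamma : (1 < n)%N -> (1 < d)%N -> `|pmin p| <= g.
Proof.
move=> n1 d1; have z := zero_eigenvalue n1 d1.
have Qs := count_sym_tr Qmx_sym.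
have [_ /(_ _ z) h1] := lambda_maxP Qs card_idx_gt0.
have [_ /(_ _ z) h2] := lambda_minP Qs card_idx_gt0.
have := gamma_max; have := gamma_min; have := spec_d_le.
rewrite ler_norml; move=> h3 h4 h5; apply/andP; split; lra.
Qed.

Variables (r : nat) (le_dr : (d <= r)%N).
Notation delta := (d%:R * (n%:R - 1) / (r%:R + 1) : R).

Lemma lifted_quad_gap_lower u : count_sym u ->
  - (4%:R * g * sN * delta * \sum_K u K ^+ 2) <= lifted_quad le_dr gap u.
Proof.
move=> us; set nu := \sum_K _.
have nu0 : 0 <= nu by apply: sumr_ge0 => K _; rewrite sqr_ge0.
have g0 := gamma_ge0; have s1 := sqrtN_ge1; have s0 : 0 <= sN := le_trans ler01 s1.
have n1 : 0 <= n%:R - 1 :> R by rewrite subr_ge0 ler1n.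
have del0 : 0 <= delta by rewrite !mulr_ge0 // invr_ge0 addr_ge0.
have [d1|d1] := leqP d 1.
  apply: (@le_trans _ _ 0).
    by rewrite oppr_le0; do 4!apply: mulr_ge0 => //.
  rewrite lifted_quad_slices; apply: sumr_ge0 => k _.
  have ed : d = 1%N by apply/eqP; rewrite eqn_leq d1 d0.
  set w := fun i => _.
  have ws : count_sym w by apply: slice_sym.
  have -> : w = (fun i => mon (fun l => w [ffun=> l]) i).
    apply/funext => i; rewrite /mon.
    have s : 'I_d by rewrite ed; exact: ord0.
    have hs k' : k' = s.
      apply/ord_inj; move: (leq_trans (ltn_ord k') d1) (leq_trans (ltn_ord s) d1).
      by rewrite !ltnS !leqn0 => /eqP-> /eqP->.
    rewrite (bigD1 s) //= big1 => [|k' /eqP[]//]; rewrite mulr1; congr (w _).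
    by apply/ffunP => k'; rewrite ffunE (hs k').
  by rewrite quad_mon; apply: gap_ge0.
have K2 : 0 <= g * sN by rewrite mulr_ge0.
have K1 : 0 <= g + `|pmin p| * sN by rewrite addr_ge0 // mulr_ge0.
have AK w : count_sym w -> - (g * sN) * (\sum_i w i ^+ 2) <= quad gap w <=
    (g + `|pmin p| * sN) * (\sum_i w i ^+ 2).
  by move=> ws; rewrite gap_lower ?gap_upper.
apply: le_trans (de_finetti_real (subnKC le_dr) n0 gap_sym us gap_ge0 AK K1 K2).
rewrite lerN2 -/nu ler_wpM2r //.
have [nn|nn] := leqP n 1.
  have -> : n%:R - 1 = 0 :> R.
    by apply/eqP; rewrite subr_eq0 pnatr_eq1 eqn_leq nn n0.
  by rewrite mulr0 mul0r !mulr0.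
rewrite ler_wpM2r //.
have h := pmin_le_gamma nn d1.
have h2 : `|pmin p| * sN <= g * sN by rewrite ler_wpM2r.
have h3 : g <= g * sN by rewrite ler_peMr.
lra.
Qed.

Lemma spectral_gap_bound :
  pmin p - spectral_bound le_dr p
  <= g * (sN / alpha) * (4%:R * d%:R * (n%:R - 1) / (r%:R + 1)).
Proof.
set eps := (X in _ <= X).
have a0 := alpha_gt0.
have epsE : eps * alpha = 4%:R * g * sN * delta.
  by rewrite /eps; field; rewrite natr1 pnatr_eq0 /= gt_eqF.
have feas : feasible le_dr (pmin p - eps).
  move=> u us; have := lifted_quad_gap_lower us.
  have eps0 : 0 <= eps.
    rewrite -(pmulr_lge0 _ a0) epsE; have s1 := sqrtN_ge1.
    rewrite !mulr_ge0 ?gamma_ge0 ?(le_trans _ s1) //; first by rewrite subr_ge0 ler1n.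
    by rewrite invr_ge0 addr_ge0.
  have h1 : eps * (alpha * \sum_K u K ^+ 2) <= eps * lifted_quad le_dr Mt u.
    by rewrite ler_wpM2l // lifted_quad_sqnorm_lower.
  have -> : lifted_quad le_dr gap u = lifted_quad le_dr Qt u - pmin p * lifted_quad le_dr Mt u.
    by rewrite !lifted_quad_slices mulr_sumr -sumrB; apply: eq_bigr => k _; rewrite quad_gap.
  rewrite -epsE; move: h1; lra.
have [_ /(_ _ feas)] := spectral_boundP (ex_intro _ _ feas).
lra.
Qed.

End Bound.

Theorem theorem5p5 (R : realType) (n d : nat) (n_gt0 : (0 < n)%N)
    (d_gt0 : (0 < d)%N) (p : mpoly.mpoly n R) (p_form : is_form (2 * d)%N p)
    (r : nat) (le_dr : (d <= r)%N) :
  pmin p - spectral_bound le_dr p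
  <= gammaQ d p * (Num.sqrt (dim_sym n d)%:R / alpha_coef R d)
     * (4%:R * d%:R * (n%:R - 1) / (r%:R + 1)).
Proof. exact: spectral_gap_bound. Qed.
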